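(* Let $X=\ell_q$ (complex) with $1\le q<\infty$. A typical $T\in(\mathcal{P}_1(X),\mathrm{SOT})$ has the following properties: (a) $\|T\|=1$; (b) $\|T^nx\|\to0$ as $n\to\infty$ for all $x\in X$; (c) $T$ is not invertible; (d) $\sigma_{ap}(T)=\sigma(T)=\overline{\mathbb{D}}$. If $1<q<\infty$, a typical $T\in(\mathcal{P}_1(X),\mathrm{SOT}^* )$ also has properties (a), (b), (c) and (d).
   Context: $X=\ell_q=\ell_q(\mathbb{Z}_+)$ is equipped with its canonical basis. A vector is positive if all its coordinates are $\ge0$; a bounded operator $T$ on $X$ is positive if it maps positive vectors to positive vectors. $\mathcal{P}_1(X)$ is the set of bounded positive operators with $\|T\|\le1$. $\sigma(T)$ is the spectrum and $\sigma_{ap}(T)$ the approximate point spectrum of $T$; $\mathbb{D}$ is the open unit disk of $\mathbb{C}$. $\mathrm{SOT}$: $T_i\to T$ iff $\|T_ix-Tx\|\to0$ for every $x\in X$. $\mathrm{SOT}^*$: $T_i\to T$ iff $\|T_ix-Tx\|\to0$ for every $x\in X$ and $\|T_i^*x^*-T^*x^*\|\to0$ for every $x^*\in X^*$. ''A typical $T\in(\mathcal{P}_1(X),\tau)$ has property (P)'' means that the set of $T\in\mathcal{P}_1(X)$ with (P) is comeager, i.e. contains a dense $G_\delta$ subset of $(\mathcal{P}_1(X),\tau)$. *)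

(* Defs.v *)
From HB Require Import structures.
From mathcomp Require Import all_boot all_order all_algebra.
From mathcomp Require Import all_classical all_reals all_analysis.
From mathcomp Require Import borel_hierarchy.
From mathcomp Require Import complex.

Set Implicit Arguments.
Unset Strict Implicit.
Unset Printing Implicit Defensive.

Import Order.TTheory GRing.Theory Num.Theory.
Import numFieldNormedType.Exports.

Local Open Scope classical_set_scope.
Local Open Scope ring_scope.

(* The norm of a [normedModType R[i]] takes its values in [R[i]]; [rnorm] is
   the same number, seen in [R]. *)
Definition rnorm (R : realType) (V : normedModType R[i]) (v : V) : R :=
  complex.Re `|v|.

Section rnorm_theory.
Context {R : realType} {V : normedModType R[i]}.
Implicit Types v w : V.

Lemma rnormE v : (rnorm v)%:C%C = `|v|.
Proof. by rewrite /rnorm; apply: RRe_real; exact: normr_real. Qed.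

Lemma rnorm_ge0 v : 0 <= rnorm v.
Proof. by have := normr_ge0 v; rewrite -rnormE lecR. Qed.

Lemma rnorm0 : rnorm (0 : V) = 0.
Proof. by rewrite /rnorm normr0. Qed.

Lemma rnorm_eq0 v : rnorm v = 0 -> v = 0.
Proof. by move=> v0; apply/normr0_eq0; rewrite -rnormE v0. Qed.

Lemma ler_rnormD v w : rnorm (v + w) <= rnorm v + rnorm w.
Proof. by have := ler_normD v w; rewrite -!rnormE -rmorphD/= lecR. Qed.

Lemma rnormZ (a : R[i]) v : rnorm (a *: v) = Normc.normc a * rnorm v.
Proof.
by apply: (@complexI R); rewrite rmorphM/= !rnormE normrZ normc_def; case: a.
Qed.

End rnorm_theory.

Section lq_def.
Context {R : realType}.
Implicit Types (q : R) (x y : nat -> R[i]).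

Definition q_norm q x : \bar R :=
  'N[counting]_q%:E [EFin \o (@Normc.normc R \o x)]%E.

Definition q_summable q : {pred (nat -> R[i])} :=
  mem [set x : nat -> R[i] | (q_norm q x < +oo)%E].

Lemma normc_ge0 (z : R[i]) : 0 <= Normc.normc z.
Proof. by case: z => a b; exact: sqrtr_ge0. Qed.

Lemma q_normE q x : 0 < q ->
  q_norm q x = ((\sum_(0 <= k <oo) (Normc.normc (x k) `^ q)%:E) `^ q^-1)%E.
Proof.
move=> q0; rewrite /q_norm Lnorm_counting//; congr (_ `^ _)%E.
by apply: eq_eseriesr => k _ /=; rewrite ger0_norm// normc_ge0.
Qed.

Lemma q_norm_ge0 q x : (0 <= q_norm q x)%E.
Proof. exact: Lnorm_ge0. Qed.

Lemma q_norm0 q : 1 <= q -> q_norm q 0 = 0%E.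
Proof.
move=> q1; rewrite /q_norm (_ : _ \o _ = cst 0%E).
  by rewrite Lnorm0// eqe gt_eqF// (lt_le_trans ltr01).
by apply/funext => k; congr EFin; exact: Normc.normc0.
Qed.

Lemma q_normD q x y : 1 <= q -> (q_norm q (x + y)%R <= q_norm q x + q_norm q y)%E.
Proof.
move=> q1; have q0 : 0 < q by exact: lt_le_trans q1.
apply: le_trans (@eminkowski _ _ _ counting (@Normc.normc R \o x)
  (@Normc.normc R \o y) q%:E _ _ _) => //.
rewrite /q_norm !Lnorm_counting//; apply: gt0_ler_poweR.
- by rewrite invr_ge0 ltW.
- by rewrite in_itv/= leey andbT; apply: nneseries_ge0 => k _ _; rewrite lee_fin powR_ge0.
- by rewrite in_itv/= leey andbT; apply: nneseries_ge0 => k _ _; rewrite lee_fin powR_ge0.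
apply: lee_nneseries => [k _ _|k _]; first exact: poweR_ge0.
rewrite /= lee_fin ge0_ler_powR ?nnegrE// ?(ltW q0)//.
rewrite !ger0_norm ?addr_ge0 ?normc_ge0//.
exact: le_normcD.
Qed.

Lemma q_normZ q (a : R[i]) x : 1 <= q ->
  (q_norm q (a *: x)%R = (Normc.normc a)%:E * q_norm q x)%E.
Proof.
move=> q1; have q0 : 0 < q by exact: lt_le_trans q1.
rewrite !q_normE//.
rewrite (@eq_eseriesr _ _ (fun k => (Normc.normc a `^ q)%:E *
    (Normc.normc (x k) `^ q)%:E)%E); last first.
  by move=> k _; rewrite -EFinM -powRM ?normc_ge0// -Normc.normcM.
rewrite nneseriesZl; last by move=> k _; rewrite lee_fin powR_ge0.
rewrite poweRM; first last.
- by apply: nneseries_ge0 => k _ _; rewrite lee_fin powR_ge0.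
- by rewrite lee_fin powR_ge0.
by rewrite poweR_EFin -powRrM divff ?gt_eqF// powRr1// normc_ge0.
Qed.

Lemma q_norm_eq0 q x : 1 <= q -> q_norm q x = 0%E -> x = 0.
Proof.
move=> q1; have q0 : 0 < q by exact: lt_le_trans q1.
have xq_ge0 k : (0 <= (Normc.normc (x k) `^ q)%:E)%E by rewrite lee_fin powR_ge0.
rewrite q_normE// => /poweR_eq0_eq0 xq0.
have {}xq0 := xq0 (nneseries_ge0 (fun k _ _ => xq_ge0 k)).
apply/funext => k; apply: Normc.eq0_normc; apply: (@powR_eq0_eq0 _ _ q).
apply/eqP; rewrite eq_le powR_ge0 andbT -lee_fin.
suff: ((Normc.normc (x k) `^ q)%:E <= \sum_(0 <= j <oo) (Normc.normc (x j) `^ q)%:E)%E.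
  by rewrite xq0.
rewrite (@nneseriesD1 _ _ k)//; apply: leeDl.
by apply: nneseries_ge0 => *; exact: xq_ge0.
Qed.

Lemma q_summable_submod_closed q : 1 <= q -> submod_closed (q_summable q).
Proof.
move=> q1; split; first by rewrite inE/= q_norm0.
move=> a x y /[!inE]/= xq yq; rewrite (le_lt_trans (q_normD _ _ q1))//.
by rewrite q_normZ// lte_add_pinfty// lte_mul_pinfty// ?lee_fin ?normc_ge0// q_norm_ge0.
Qed.

Record lq q (q1 : 1 <= q) := Lq {
  lq_fun :> nat -> R[i];
  lq_summable : lq_fun \in q_summable q }.

End lq_def.

Section lq_normed.
Context {R : realType} {q : R} (q1 : 1 <= q).

#[local] HB.instance Definition _ :=
  GRing.isSubmodClosed.Build _ _ (q_summable q) (q_summable_submod_closed q1).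

HB.instance Definition _ := [isSub of lq q1 for @lq_fun R q q1].
HB.instance Definition _ := [Choice of lq q1 by <:].
HB.instance Definition _ := [SubChoice_isSubLmodule of lq q1 by <:].

Definition lq_norm (x : lq q1) : R := fine (q_norm q x).

Lemma lq_normE (x : lq q1) : (lq_norm x)%:E = q_norm q x.
Proof.
rewrite /lq_norm fineK// ge0_fin_numE ?q_norm_ge0//.
by have := lq_summable x; rewrite inE.
Qed.

Lemma lq_normD (x y : lq q1) : lq_norm (x + y) <= lq_norm x + lq_norm y.
Proof. by rewrite -lee_fin EFinD !lq_normE; exact: q_normD. Qed.

Lemma lq_normZ (a : R[i]) (x : lq q1) :
  lq_norm (a *: x) = Normc.normc a * lq_norm x.
Proof. by apply: EFin_inj; rewrite EFinM !lq_normE; exact: q_normZ. Qed.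

Lemma lq_norm_eq0 (x : lq q1) : lq_norm x = 0 -> x = 0.
Proof.
by move=> x0; apply/val_inj/(q_norm_eq0 q1); rewrite /= -lq_normE x0.
Qed.

Let lq_cnorm (x : lq q1) : R[i] := (lq_norm x)%:C%C.

Let lq_cnormD x y : lq_cnorm (x + y) <= lq_cnorm x + lq_cnorm y.
Proof. by rewrite -rmorphD/= lecR lq_normD. Qed.

Let lq_cnormZ (a : R[i]) x : lq_cnorm (a *: x) = `|a| * lq_cnorm x.
Proof. by rewrite /lq_cnorm lq_normZ rmorphM/=; case: a. Qed.

Let lq_cnorm_eq0 x : lq_cnorm x = 0 -> x = 0.
Proof. by move/complexI/lq_norm_eq0. Qed.

HB.instance Definition _ := Lmodule_isNormed.Build R[i] (lq q1)
  lq_cnormD lq_cnormZ lq_cnorm_eq0.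

Lemma rnorm_lq (x : lq q1) : rnorm x = fine (q_norm q x).
Proof. by []. Qed.

End lq_normed.

Section bop_def.
Context {R : realType}.
Variables V W : normedModType R[i].

Definition bounded_linear : {pred (V -> W)} :=
  mem [set f : V -> W |
    linear f /\ exists M : R, forall x, rnorm (f x) <= M * rnorm x].

Lemma bounded_linear_submod_closed : submod_closed bounded_linear.
Proof.
split.
  rewrite inE/=; split=> [a x y|]; first by rewrite /= scaler0 addr0.
  by exists 0 => x; rewrite mul0r rnorm0.
move=> a f g /[!inE]/= -[lf [M fM]] [lg [N gN]]; split.
  move=> b x y.
  rewrite -[LHS]/(a *: f (b *: x + y) + g (b *: x + y)).
  rewrite -[RHS]/(b *: (a *: f x + g x) + (a *: f y + g y)) lf lg.
  by rewrite !scalerDr !scalerA (mulrC b) addrACA.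
exists (Normc.normc a * M + N) => x; rewrite (le_trans (ler_rnormD _ _))//.
by rewrite mulrDl lerD// rnormZ -mulrA ler_wpM2l ?normc_ge0.
Qed.

Record bop := Bop {
  bop_fun :> V -> W;
  bop_bounded_linear : bop_fun \in bounded_linear }.

#[local] HB.instance Definition _ :=
  GRing.isSubmodClosed.Build _ _ bounded_linear bounded_linear_submod_closed.

HB.instance Definition _ := [isSub of bop for bop_fun].
HB.instance Definition _ := [Choice of bop by <:].
HB.instance Definition _ := [SubChoice_isSubLmodule of bop by <:].

Lemma bop_linear (T : bop) : linear T.
Proof. by have := bop_bounded_linear T; rewrite inE => -[]. Qed.

HB.instance Definition _ (T : bop) :=
  GRing.isLinear.Build R[i] V W _ (bop_fun T) (bop_linear T).

Lemma bop_bounded (T : bop) : exists M : R, forall x, rnorm (T x) <= M * rnorm x.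
Proof. by have := bop_bounded_linear T; rewrite inE => -[]. Qed.

Definition opnorm (T : bop) : R :=
  sup [set rnorm (T x) | x in [set x | rnorm x <= 1]].

Lemma opnorm_has_sup (T : bop) :
  has_sup [set rnorm (T x) | x in [set x | rnorm x <= 1]].
Proof.
split; first by exists (rnorm (T 0)), 0 => //=; rewrite rnorm0.
have [M TM] := bop_bounded T; exists `|M| => _ [x /= x1 <-].
rewrite (le_trans (TM x))// (le_trans (ler_wpM2r (rnorm_ge0 x) (ler_norm M)))//.
by rewrite ler_piMr.
Qed.

Lemma opnorm_ge0 (T : bop) : 0 <= opnorm T.
Proof.
apply: le_trans (rnorm_ge0 (T 0)) _; apply: sup_ubound.
  by have [] := opnorm_has_sup T.
by exists 0 => //=; rewrite rnorm0.
Qed.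

Lemma le_opnorm (T : bop) x : rnorm (T x) <= opnorm T * rnorm x.
Proof.
have [x0|x0] := eqVneq (rnorm x) 0.
  by rewrite (rnorm_eq0 x0) linear0 !rnorm0 mulr0.
have x_gt0 : 0 < rnorm x by rewrite lt_def x0 rnorm_ge0.
rewrite -ler_pdivrMr// mulrC.
have <- : rnorm (T ((rnorm x)^-1%:C%C *: x)) = (rnorm x)^-1 * rnorm (T x).
  by rewrite linearZ rnormZ /= expr0n/= addr0 sqrtr_sqr ger0_norm// invr_ge0 ltW.
apply: sup_ubound; first by have [] := opnorm_has_sup T.
exists ((rnorm x)^-1%:C%C *: x) => //=.
rewrite rnormZ /= expr0n/= addr0 sqrtr_sqr ger0_norm ?invr_ge0 ?(ltW x_gt0)//.
by rewrite mulVf.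
Qed.

Lemma opnorm_le (T : bop) (M : R) : 0 <= M ->
  (forall x, rnorm (T x) <= M * rnorm x) -> opnorm T <= M.
Proof.
move=> M0 TM; apply: ge_sup; first by have [] := opnorm_has_sup T.
by move=> _ [x /= x1 <-]; rewrite (le_trans (TM x))// ler_piMr.
Qed.

Lemma opnormD (S T : bop) : opnorm (S + T) <= opnorm S + opnorm T.
Proof.
apply: opnorm_le => [|x]; first by rewrite addr_ge0 ?opnorm_ge0.
by rewrite mulrDl (le_trans (ler_rnormD (S x) (T x)))// lerD ?le_opnorm.
Qed.

Lemma opnormZ_le (a : R[i]) (T : bop) :
  opnorm (a *: T) <= Normc.normc a * opnorm T.
Proof.
apply: opnorm_le => [|x]; first by rewrite mulr_ge0 ?opnorm_ge0 ?normc_ge0.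
by rewrite -[X in rnorm X]/(a *: T x) rnormZ -mulrA ler_wpM2l ?normc_ge0 ?le_opnorm.
Qed.

Lemma opnormZ (a : R[i]) (T : bop) : opnorm (a *: T) = Normc.normc a * opnorm T.
Proof.
apply/eqP; rewrite eq_le opnormZ_le/=.
have [->|a0] := eqVneq a 0; first by rewrite Normc.normc0 mul0r opnorm_ge0.
have na0 : 0 < Normc.normc a.
  by rewrite lt_def normc_ge0 andbT; apply: contra_neq a0 => /Normc.eq0_normc.
rewrite -ler_pdivlMl// -Normc.normcV -[in leLHS](scale1r T) -(mulVf a0) -scalerA.
exact: opnormZ_le.
Qed.

Lemma opnorm_eq0 (T : bop) : opnorm T = 0 -> T = 0.
Proof.
move=> T0; apply/val_inj/funext => x; apply: rnorm_eq0; apply/eqP.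
by rewrite eq_le rnorm_ge0 andbT -(mul0r (rnorm x)) -T0 le_opnorm.
Qed.

Let cnorm (T : bop) : R[i] := (opnorm T)%:C%C.

Let cnormD S T : cnorm (S + T) <= cnorm S + cnorm T.
Proof. by rewrite -rmorphD/= lecR opnormD. Qed.

Let cnormZ (a : R[i]) T : cnorm (a *: T) = `|a| * cnorm T.
Proof. by rewrite /cnorm opnormZ rmorphM/=; case: a. Qed.

Let cnorm_eq0 T : cnorm T = 0 -> T = 0.
Proof. by move/complexI/opnorm_eq0. Qed.

HB.instance Definition _ := Lmodule_isNormed.Build R[i] bop
  cnormD cnormZ cnorm_eq0.

Lemma rnorm_bop (T : bop) : rnorm T = opnorm T.
Proof. by []. Qed.

End bop_def.

Section bop_comp.
Context {R : realType} {U V W : normedModType R[i]}.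

Lemma bounded_linear_comp (S : bop V W) (T : bop U V) :
  (S : V -> W) \o T \in @bounded_linear R U W.
Proof.
rewrite inE; split => [a x y|]; first by rewrite /= !linearP.
exists (opnorm S * opnorm T) => x /=; rewrite (le_trans (le_opnorm _ _))// -mulrA.
by rewrite ler_wpM2l ?opnorm_ge0 ?le_opnorm.
Qed.

Definition bop_comp (S : bop V W) (T : bop U V) : bop U W :=
  Bop (bounded_linear_comp S T).

End bop_comp.

Section bop_id.
Context {R : realType} (V : normedModType R[i]).

Lemma bounded_linear_id : (idfun : V -> V) \in @bounded_linear R V V.
Proof. by rewrite inE; split => //; exists 1 => x; rewrite mul1r. Qed.

Definition bop_id : bop V V := Bop bounded_linear_id.

End bop_id.

Lemma initial_cvgP (S : choiceType) (T : topologicalType) (f : S -> T)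
    (F : set_system S) (s : S) : Filter F ->
  F --> (s : initial_topology f) <-> f @ F --> f s.
Proof.
move=> FF; split=> [Fs|fFs A [_ [[B oB <-] Bfs BA]]].
  exact: (cvg_comp _ _ Fs (@initial_continuous S T f s)).
by apply: (filterS BA); apply: fFs; exact: open_nbhs_nbhs.
Qed.

Section strong_operator_topologies.
Context {R : realType}.
Implicit Types V W : normedModType R[i].

Definition dual V := bop V R[i]^o.

Definition adjoint V W (T : bop V W) (phi : dual W) : dual V :=
  bop_comp phi T.

Definition SOT V W : topologicalType :=
  initial_topology (fun T : bop V W => (T : {ptws V -> W})).

Definition SOTstar V W : topologicalType :=
  initial_topology (fun T : bop V W =>
    ((T : {ptws V -> W}), (adjoint T : {ptws dual W -> dual V}))).

Lemma SOT_cvgP V W (F : set_system (bop V W)) (T : bop V W) : Filter F ->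
  F --> (T : SOT V W) <-> forall x, S x @[S --> F] --> T x.
Proof. by move=> FF; rewrite initial_cvgP; exact: pointwise_cvgP. Qed.

Lemma SOTstar_cvgP V W (F : set_system (bop V W)) (T : bop V W) : Filter F ->
  F --> (T : SOTstar V W) <->
  (forall x, S x @[S --> F] --> T x) /\
  (forall phi, adjoint S phi @[S --> F] --> adjoint T phi).
Proof.
move=> FF; rewrite initial_cvgP; split.
  move=> FT; split.
    apply/(@pointwise_cvgP V W (@bop_fun _ V W @ F)).
    exact: (cvg_comp _ _ FT (@cvg_fst _ _ _ _ _)).
  apply/(@pointwise_cvgP (dual W) (dual V) (@adjoint V W @ F)).
  exact: (cvg_comp _ _ FT (@cvg_snd _ _ _ _ _)).
move=> [FT FT'].
have {}FT : (fun S : bop V W => (S : {ptws V -> W})) @ F --> (T : {ptws V -> W}).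
  exact/(@pointwise_cvgP V W (@bop_fun _ V W @ F)).
have {}FT' : (fun S : bop V W => (adjoint S : {ptws dual W -> dual V})) @ F -->
    (adjoint T : {ptws dual W -> dual V}).
  exact/(@pointwise_cvgP (dual W) (dual V) (@adjoint V W @ F)).
exact: (@cvg_pair _ _ _ F _ _ FF _ _ _ _ FT FT').
Qed.

End strong_operator_topologies.

Section spectrum.
Context {R : realType} {V : normedModType R[i]}.
Implicit Type T : bop V V.

Definition invertible T := exists S : bop V V,
  bop_comp S T = bop_id V /\ bop_comp T S = bop_id V.

Definition spectrum T : set R[i]^o :=
  [set l : R[i] | ~ invertible (T - l *: bop_id V)].

Definition ap_spectrum T : set R[i]^o :=
  [set l : R[i] | exists2 x : nat -> V, (forall n, rnorm (x n) = 1) &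
    rnorm (T (x n) - l *: x n) @[n --> \oo] --> (0 : R)].

End spectrum.

Definition unit_disk (R : realType) : set R[i]^o := [set z : R[i] | `|z| < 1].
Arguments unit_disk : clear implicits.

(* [A] carries the topology induced by [X]. *)
Definition typical (X : topologicalType) (A P : set X) :=
  exists G : set (set_type A), [/\ Gdelta G, dense G & G `<=` set_val @^-1` P].

Section positive_contractions.
Context {R : realType} {q : R} (q1 : 1 <= q).
Let X := lq q1.

(* In [R[i]], [0 <= z] means that [z] is real and nonnegative. *)
Definition positive_vector (x : X) := forall k, 0 <= x k.

Definition positive_operator (T : bop X X) :=
  forall x, positive_vector x -> positive_vector (T x).

Definition positive_contractions : set (bop X X) :=
  [set T | positive_operator T /\ opnorm T <= 1].

Definition typical_properties : set (bop X X) := [set T |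
  [/\ opnorm T = 1,
      forall x : X, rnorm (iter n T x) @[n --> \oo] --> (0 : R),
      ~ invertible T
    & ap_spectrum T = spectrum T /\
      spectrum T = closure (unit_disk R)]].

End positive_contractions.

Arguments positive_contractions {R q} q1.
Arguments typical_properties {R q} q1.

(* Main.v *)
Require Import Defs.
From mathcomp Require Import all_boot all_order all_algebra.
From mathcomp Require Import all_classical all_reals all_analysis.
From mathcomp Require Import complex.
From mathcomp Require Import lra ring.

Set Implicit Arguments.
Unset Strict Implicit.
Unset Printing Implicit Defensive.

Import Order.TTheory GRing.Theory Num.Theory.
Import numFieldNormedType.Exports.

Local Open Scope classical_set_scope.
Local Open Scope ring_scope.

(** The theorem holds because each property of the list follows from countably
    many conditions that are open for the strong operator topology, and because
    operators satisfying all these conditions at once can be written down and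
    are dense among the positive contractions. The conditions then define a
    dense Gdelta set.

    The open conditions are of two kinds. The first one, [shift_like], asks that
    [T] acts on some long chain of consecutive basis vectors almost as the
    backward shift, the first vector being sent almost to 0. Such an operator
    has norm 1, and truncated geometric series along the chain are approximate
    eigenvectors for every [l] in the open disk, hence for its closure; since
    the spectrum of a contraction is contained in the closed disk (this uses the
    completeness of lq), this determines the spectrum and the approximate point
    spectrum, and shows that [T] is not invertible. The second one,
    [vanishing_orbit], asks for a pseudo-orbit from a basis vector to a
    neighbourhood of 0; for a contraction, it makes all orbits tend to 0. That
    these conditions suffice is [shift_like_typical_properties].

    The dense family consists of the operators [approximant T N], which act on
    the first [N] coordinates as a compression of [T] scaled by a factor less
    than 1, and on the remaining ones as the backward shift. They are positive
    contractions because the q-th powers of norms add over disjoint supports,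
    and they satisfy all the open conditions. They converge strongly to [T]
    because the tails of a fixed vector tend to 0. The convergence of their
    adjoints rests on [dual_tail_cvg0]: when [1 < q], the restrictions of a
    bounded functional to the tails tend to 0 in norm. *)

(** * Real-valued norms *)

Section norms.
Context {R : realType} {V : normedModType R[i]}.
Implicit Types v w : V.

Lemma normc_real (r : R) : 0 <= r -> Normc.normc r%:C%C = r.
Proof. by move=> r0; rewrite /= expr0n addr0 sqrtr_sqr ger0_norm. Qed.

Lemma normc_nat n : Normc.normc (n%:R : R[i]) = n%:R.
Proof. by rewrite -(rmorph_nat (@real_complex R)) normc_real. Qed.

Lemma normcX (z : R[i]) n : Normc.normc (z ^+ n) = Normc.normc z ^+ n.
Proof.
by elim: n => [|n IH]; rewrite ?expr0 ?Normc.normc1// !exprS Normc.normcM IH.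
Qed.

Lemma ler_normcD (x y : R[i]) :
  Normc.normc (x + y) <= Normc.normc x + Normc.normc y.
Proof. exact: le_normcD. Qed.

Lemma rnormN v : rnorm (- v) = rnorm v.
Proof. by rewrite /rnorm normrN. Qed.

Lemma rnormC v w : rnorm (v - w) = rnorm (w - v).
Proof. by rewrite -rnormN opprB. Qed.

Lemma ler_rnormB v w : rnorm (v - w) <= rnorm v + rnorm w.
Proof. by rewrite (le_trans (ler_rnormD _ _))// rnormN. Qed.

Lemma ler_rnorm_distD w u v : rnorm (u - v) <= rnorm (u - w) + rnorm (w - v).
Proof. by rewrite -[in leLHS](subrK w u) -addrA ler_rnormD. Qed.

Lemma rnormZ_real (r : R) v : 0 <= r -> rnorm (r%:C%C *: v) = r * rnorm v.
Proof. by move=> r0; rewrite rnormZ normc_real. Qed.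

Lemma exists_unit_multiple v : v != 0 ->
  exists2 c : R, 0 < c & rnorm (c%:C%C *: v) = 1.
Proof.
move=> v0; have nv : 0 < rnorm v.
  by rewrite lt_def rnorm_ge0 andbT; apply: contra_neq v0 => /rnorm_eq0.
exists (rnorm v)^-1; rewrite ?invr_gt0//.
by rewrite rnormZ_real ?invr_ge0 ?rnorm_ge0// mulVf// gt_eqF.
Qed.

(** The positive elements of [R[i]] are the positive reals, so real epsilons
    describe the topology of a normed module over [R[i]]. *)
Lemma cvg_rnormP (T : Type) (F : set_system T) (f : T -> V) v : Filter F ->
  f @ F --> v <-> forall e : R, 0 < e -> \forall t \near F, rnorm (f t - v) < e.
Proof.
move=> FF; split=> [fv e e0|fv].
  move/cvgrPdist_lt: fv => /(_ e%:C%C); rewrite ltcR => /(_ e0).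
  by apply: filterS => t; rewrite -rnormE ltcR rnormC.
apply/cvgrPdist_lt => -[e e'] /=; rewrite ltcE/= => /andP[/eqP e'0 e0].
apply: filterS (fv _ e0) => t; rewrite -rnormE ltcE/= -e'0 eqxx/=.
by rewrite rnormC.
Qed.

End norms.

(** * The norm of lq through partial power sums *)

Section powers.
Context {R : realType} (q : R) (q0 : 0 < q).

Lemma powR_le_inj (a b : R) : 0 <= a -> 0 <= b -> a `^ q <= b `^ q -> a <= b.
Proof.
move=> a0 b0; apply: contraTT; rewrite -!ltNge => ba.
by apply: gt0_ltr_powR; rewrite ?nnegrE.
Qed.

Lemma powR_le (a b : R) : 0 <= a -> a <= b -> a `^ q <= b `^ q.
Proof.
by move=> a0 ab; apply: ge0_ler_powR; rewrite ?nnegrE ?(ltW q0)// (le_trans a0).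
Qed.

Lemma powRKV (a : R) : 0 <= a -> (a `^ q^-1) `^ q = a.
Proof. by move=> a0; rewrite -powRrM mulVf ?gt_eqF// powRr1. Qed.

End powers.

Section power_sums.
Context {R : realType} (q : R) (q1 : 1 <= q).
Implicit Types (x y : nat -> R[i]) (M : R).

Let q0 : 0 < q. Proof. exact: lt_le_trans q1. Qed.

(** Finite sums keep the extended reals out of the way: by [rnorm_leP] below,
    every norm estimate in lq is an estimate uniform in [n] on these sums. *)
Definition pow_sum x n : R := \sum_(0 <= k < n) Normc.normc (x k) `^ q.

Lemma pow_sum_ge0 x n : 0 <= pow_sum x n.
Proof. by apply: sumr_ge0 => k _; exact: powR_ge0. Qed.

Lemma pow_sumS x n : pow_sum x n.+1 = pow_sum x n + Normc.normc (x n) `^ q.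
Proof. by rewrite /pow_sum big_nat_recr. Qed.

Lemma nondecreasing_pow_sum x m n : (m <= n)%N -> pow_sum x m <= pow_sum x n.
Proof.
move/subnK <-; elim: (n - m)%N => [|k IH]; first by rewrite add0n.
by rewrite addSn pow_sumS (le_trans IH)// lerDl powR_ge0.
Qed.

Lemma q_norm_leP x M : 0 <= M ->
  (q_norm q x <= M%:E)%E <-> forall n, pow_sum x n <= M `^ q.
Proof.
move=> M0; have xq0 k : (0 <= (Normc.normc (x k) `^ q)%:E)%E.
  by rewrite lee_fin powR_ge0.
have S0 : (0 <= \sum_(0 <= k <oo) (Normc.normc (x k) `^ q)%:E)%E.
  by apply: nneseries_ge0 => k _ _; exact: xq0.
rewrite q_normE//; split=> [xM n|xM].
  rewrite -lee_fin /pow_sum -sumEFin.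
  apply: (le_trans (nneseries_lim_ge n (fun k _ _ => xq0 k))).
  have itv0 (z : \bar R) : (0 <= z)%E -> z \in `[0%E, +oo%E].
    by move=> z0; rewrite in_itv/= z0 leey.
  have /= := gt0_ler_poweR (ltW q0) (itv0 _ (poweR_ge0 _ _)) (itv0 M%:E M0) xM.
  by rewrite -poweRrM mulVf ?gt_eqF// poweRe1.
have -> : (M%:E = (M `^ q)%:E `^ q^-1)%E.
  by rewrite poweR_EFin -powRrM mulfV ?gt_eqF// powRr1.
apply: gt0_ler_poweR.
- by rewrite invr_ge0 ltW.
- by rewrite in_itv/= leey andbT.
- by rewrite in_itv/= leey andbT lee_fin powR_ge0.
apply: lime_le; first by apply: is_cvg_nneseries => k _ _; exact: xq0.
by near=> n; rewrite sumEFin lee_fin; exact: xM.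
Unshelve. all: by end_near. Qed.

Lemma bounded_pow_sum_summable x M : (forall n, pow_sum x n <= M) ->
  x \in q_summable q.
Proof.
move=> xM; have M0 : 0 <= M by apply: le_trans (xM 0%N); exact: pow_sum_ge0.
rewrite inE/=; apply: (@le_lt_trans _ _ (M `^ q^-1)%:E); last exact: ltry.
by apply/q_norm_leP => [|n]; rewrite ?powR_ge0// powRKV.
Qed.

Implicit Types u v : lq q1.

Lemma rnorm_leP u M : 0 <= M ->
  rnorm u <= M <-> forall n, pow_sum u n <= M `^ q.
Proof. by move=> M0; rewrite -q_norm_leP// -lq_normE lee_fin. Qed.

Lemma pow_sum_le_rnorm u n : pow_sum u n <= rnorm u `^ q.
Proof. by move: n; apply/(rnorm_leP u (rnorm_ge0 u)). Qed.

Lemma normc_coord_le u k : Normc.normc (u k) <= rnorm u.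
Proof.
apply: (powR_le_inj q0); rewrite ?normc_ge0 ?rnorm_ge0//.
apply: le_trans (pow_sum_le_rnorm u k.+1).
by rewrite pow_sumS lerDr pow_sum_ge0.
Qed.

End power_sums.

(** * Completeness of lq *)

Section completeness.
Context {R : realType}.

Lemma real_cauchy_seq (a : nat -> R) :
  (forall e : R, 0 < e -> exists N, forall m n, (N <= m)%N -> (N <= n)%N ->
    `|a m - a n| <= e) ->
  exists l : R, forall e : R, 0 < e -> exists N, forall n, (N <= n)%N ->
    `|a n - l| <= e.
Proof.
move=> ca.
have /cauchy_cvg cva : cauchy (a @ \oo).
  apply: cauchy_exP => e e0; have [|N aN] := ca (e / 2); first by rewrite divr_gt0.
  exists (a N); exists N => // n /= Nn; rewrite /ball/=.
  by apply: le_lt_trans (aN _ _ (leqnn N) Nn) _; rewrite ltr_pdivrMr// ltr_pMr// ltr1n.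
exists (lim (a @ \oo)) => e e0.
move/cvgrPdist_le: cva => /(_ e e0) [N _ aN]; exists N => n Nn.
by rewrite distrC; exact: aN.
Qed.

Lemma complex_cauchy_seq (a : nat -> R[i]) :
  (forall e : R, 0 < e -> exists N, forall m n, (N <= m)%N -> (N <= n)%N ->
    Normc.normc (a m - a n) <= e) ->
  exists l : R[i], forall e : R, 0 < e -> exists N, forall n, (N <= n)%N ->
    Normc.normc (a n - l) <= e.
Proof.
have Re_le (z : R[i]) : `|complex.Re z| <= Normc.normc z.
  by case: z => x y /=; rewrite -sqrtr_sqr ler_sqrt ?lerDl ?addr_ge0 ?sqr_ge0.
have Im_le (z : R[i]) : `|complex.Im z| <= Normc.normc z.
  by case: z => x y /=; rewrite -sqrtr_sqr ler_sqrt ?lerDr ?addr_ge0 ?sqr_ge0.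
have le_ReIm (z : R[i]) : Normc.normc z <= `|complex.Re z| + `|complex.Im z|.
  case: z => x y /=; rewrite -(ger0_norm (addr_ge0 (normr_ge0 x) (normr_ge0 y))).
  rewrite -sqrtr_sqr ler_sqrt ?sqr_ge0// sqrrD !real_normK ?num_real//.
  by rewrite -addrA lerD2l lerDr mulrn_wge0// mulr_ge0.
move=> ca.
have [|l lP] := @real_cauchy_seq (fun n => complex.Re (a n)).
  move=> e /ca[N aN]; exists N => m n Nm Nn; apply: le_trans (aN m n Nm Nn).
  by apply: le_trans (Re_le _); case: (a m) (a n) => [? ?] [].
have [|l' l'P] := @real_cauchy_seq (fun n => complex.Im (a n)).
  move=> e /ca[N aN]; exists N => m n Nm Nn; apply: le_trans (aN m n Nm Nn).
  by apply: le_trans (Im_le _); case: (a m) (a n) => [? ?] [].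
exists (l +i* l')%C => e e0; have e20 : 0 < e / 2 by rewrite divr_gt0.
have [N NP] := lP _ e20; have [N' N'P] := l'P _ e20.
exists (maxn N N') => n; rewrite geq_max => /andP[Nn N'n].
apply: le_trans (le_ReIm _) _; rewrite (splitr e).
by have := lerD (NP n Nn) (N'P n N'n); case: (a n).
Qed.

Variables (q : R) (q1 : 1 <= q).
Let q0 : 0 < q. Proof. exact: lt_le_trans q1. Qed.

Definition truncate (K : nat) (x : nat -> R[i]) : nat -> R[i] :=
  fun k => if (k < K)%N then x k else 0.

Lemma pow_sum_truncate K x n : pow_sum q (truncate K x) n = pow_sum q x (minn n K).
Proof.
elim: n => [|n IH]; first by rewrite min0n /pow_sum !big_nil.
rewrite pow_sumS IH /truncate; case: ltnP => nK.
  by rewrite (minn_idPl nK) pow_sumS.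
by rewrite Normc.normc0 powR0 ?gt_eqF// addr0 (minn_idPr (leqW nK)).
Qed.

Lemma q_norm_truncate_leP K x M : 0 <= M ->
  (q_norm q (truncate K x) <= M%:E)%E <-> pow_sum q x K <= M `^ q.
Proof.
move=> M0; rewrite q_norm_leP//; split=> [/(_ K)|xM n]; rewrite pow_sum_truncate.
  by rewrite minnn.
by apply: le_trans xM; rewrite nondecreasing_pow_sum// geq_minr.
Qed.

(** Uniform smallness on finitely many coordinates implies smallness in norm;
    the constant [K] is crude but only has to be independent of [d]. *)
Lemma q_norm_truncate_le K x d : 0 <= d ->
  (forall k, (k < K)%N -> Normc.normc (x k) <= d) ->
  (q_norm q (truncate K x) <= (K%:R * d)%:E)%E.
Proof.
move=> d0 xd; apply/q_norm_truncate_leP; first by rewrite mulr_ge0.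
rewrite powRM//; apply: (@le_trans _ _ (K%:R * d `^ q)).
  rewrite mulr_natl -[K in leRHS]subn0 -sumr_const_nat.
  apply: ler_sum_nat => k /andP[_ kK].
  by apply: powR_le => //; [exact: normc_ge0|exact: xd].
(* K <= K `^ q because 1 <= q and K is 0 or at least 1 *)
rewrite ler_wpM2r ?powR_ge0//.
have [->|K0] := posnP K; first by rewrite powR_ge0.
by rewrite -{1}(@powRr1 _ K%:R)// ler_powR// ler1n.
Qed.

(** The limit is taken coordinate by coordinate. It is not yet known to lie in
    lq, so the triangle inequality is applied to truncations, on which
    coordinatewise convergence is uniform; letting the truncation grow bounds
    all partial sums of the difference. *)
Theorem lq_cauchy_seq (u : nat -> lq q1) :
  (forall e : R, 0 < e -> exists N, forall m n, (N <= m)%N -> (N <= n)%N ->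
    rnorm (u m - u n) <= e) ->
  exists y : lq q1, forall e : R, 0 < e -> exists N, forall n, (N <= n)%N ->
    rnorm (u n - y) <= e.
Proof.
move=> cu.
have /choice[y yP] : forall k, exists l : R[i], forall e : R, 0 < e ->
    exists N, forall n, (N <= n)%N -> Normc.normc (u n k - l) <= e.
  move=> k; apply: complex_cauchy_seq => e /cu[N uN]; exists N => m n Nm Nn.
  exact: le_trans (normc_coord_le (u m - u n) k) (uN m n Nm Nn).
(* convergence is uniform on any finite set of coordinates *)
have unifK K e : 0 < e -> exists N, forall n, (N <= n)%N ->
    forall k, (k < K)%N -> Normc.normc (u n k - y k) <= e.
  move=> e0; elim: K => [|K [N NP]]; first by exists 0%N.
  have [N' N'P] := yP K e e0; exists (maxn N N') => n; rewrite geq_max.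
  move=> /andP[Nn N'n] k; rewrite ltnS leq_eqVlt => /predU1P[->|kK].
    exact: N'P.
  exact: NP.
have tail e : 0 < e -> exists N, forall n, (N <= n)%N ->
    forall K, pow_sum q ((u n : nat -> R[i]) - y) K <= e `^ q.
  move=> e0; have [N uN] := cu e e0; exists N => n Nn K.
  apply/(q_norm_truncate_leP _ _ (ltW e0))/lee_addgt0Pr => d d0.
  have [|N' N'P] := @unifK K (d / K.+1%:R); first by rewrite divr_gt0.
  set m := maxn N N'.
  have -> : truncate K ((u n : nat -> R[i]) - y) =
      truncate K ((u n : nat -> R[i]) - u m) + truncate K ((u m : nat -> R[i]) - y).
    apply/funext => k; rewrite /truncate /= !fctE.
    by case: ifP => _; rewrite ?addr0// addrA subrK.
  apply: le_trans (q_normD _ _ q1) _; apply: leeD.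
    apply/q_norm_truncate_leP; first exact: ltW.
    apply: le_trans (pow_sum_le_rnorm (u n - u m) K) _.
    by rewrite powR_le// ?rnorm_ge0// uN// leq_maxl.
  apply: le_trans (@q_norm_truncate_le _ _ (d / K.+1%:R) _ _) _.
  - by rewrite divr_ge0// ltW.
  - by move=> k kK; apply: N'P => //; rewrite leq_maxr.
  rewrite lee_fin mulrA ler_pdivrMr// mulrC ler_wpM2l ?(ltW d0)//.
  by rewrite ler_nat.
have [N NP] := tail 1 ltr01.
have dy : (u N : nat -> R[i]) - y \in q_summable q.
  by apply: bounded_pow_sum_summable (NP N (leqnn N)).
pose z : lq q1 := u N - Lq q1 dy.
have zE : (z : nat -> R[i]) = y.
  apply/funext => k.
  by rewrite -[LHS]/(u N k - (u N k - y k)) opprB addrC subrK.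
exists z => e e0; have [N' N'P] := tail e e0; exists N' => n N'n.
apply/rnorm_leP; first exact: ltW.
move=> K; have := N'P n N'n K; rewrite -zE; exact.
Qed.

End completeness.

(** * Spectra of bounded operators *)

Section bounded_operators.
Context {R : realType}.
Implicit Types V W : normedModType R[i].

Lemma ler_bop V W (T : bop V W) x : opnorm T <= 1 -> rnorm (T x) <= rnorm x.
Proof.
by move=> T1; rewrite (le_trans (le_opnorm T x))// ler_piMl ?rnorm_ge0.
Qed.

Lemma invertible_of_bounded_below V (T : bop V V) (c : R) : 0 < c ->
  (forall x, c * rnorm x <= rnorm (T x)) -> (forall y, exists x, T x = y) ->
  invertible T.
Proof.
move=> c0 cT /choice[g Tg].
have injT x y : T x = T y -> x = y.
  move=> Txy; apply/eqP; rewrite -subr_eq0; apply/eqP/rnorm_eq0/eqP.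
  rewrite eq_le rnorm_ge0 andbT -(pmulr_rle0 _ c0) (le_trans (cT _))//.
  by rewrite linearB/= Txy subrr rnorm0.
have gbl : g \in @bounded_linear R V V.
  rewrite inE; split; first by move=> a x y; apply: injT; rewrite linearP/= !Tg.
  by exists c^-1 => x; rewrite ler_pdivlMl// (le_trans (cT _))// Tg.
exists (Bop gbl); split; apply/val_inj/funext => x /=; last exact: Tg.
by apply: injT; rewrite Tg.
Qed.

Lemma ap_spectrum_spectrum V (T : bop V V) : ap_spectrum T `<=` spectrum T.
Proof.
move=> l [x x1 /cvgrPdist_lt Tlx] [S [STl _]].
have S0 : 0 < opnorm S + 1 by rewrite ltr_wpDl ?opnorm_ge0.
have [|N _ /(_ N (leqnn N))] := Tlx (opnorm S + 1)^-1; first by rewrite invr_gt0.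
rewrite /= sub0r normrN ger0_norm ?rnorm_ge0//.
rewrite ltNge => /negP; apply; rewrite -[leLHS]mul1r ler_pdivrMr//.
have {1}<- : rnorm (S (T (x N) - l *: x N)) = 1.
  by have /= -> := congr1 (fun B : bop V V => B (x N)) STl; exact: x1.
rewrite (le_trans (le_opnorm _ _))// mulrC ler_wpM2l ?rnorm_ge0//.
by rewrite lerDl.
Qed.

(** Normalizing an approximate eigenvector of norm at least 1 does not increase
    the error, and moving the eigenvalue by at most [e] costs at most [e] more.
    Hence eigenvalues inside the disk also serve the points of the circle. *)
Lemma ap_spectrum_approx V (T : bop V V) l : opnorm T <= 1 ->
  (forall e : R, 0 < e -> exists l' x, [/\ Normc.normc (l' - l) <= e,
    1 <= rnorm x & rnorm (T x - l' *: x) <= e]) ->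
  ap_spectrum T l.
Proof.
move=> T1 Tl.
have /choice[x xP] : forall n, exists x, rnorm x = 1 /\
    rnorm (T x - l *: x) <= 2 * n.+1%:R^-1.
  move=> n; have e0 : 0 < n.+1%:R^-1 :> R by rewrite invr_gt0.
  have [l' [y [l'l y1 Ty]]] := Tl _ e0.
  have y0 : y != 0 by apply: contraTneq y1 => ->; rewrite rnorm0 ler10.
  have [c c0 cy] := exists_unit_multiple y0.
  have c1 : c <= 1.
    by rewrite -cy rnormZ_real ?(ltW c0)// ler_peMr// ltW.
  exists (c%:C%C *: y); split => //; set z := _ *: y.
  have -> : T z - l *: z = c%:C%C *: (T y - l' *: y) + (l' - l) *: z.
    rewrite linearZ/= scalerBr scalerBl addrA; congr (_ - _).
    by rewrite /z !scalerA (mulrC l') subrK.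
  rewrite (le_trans (ler_rnormD _ _))// (rnormZ _ z) (cy : rnorm z = 1) mulr1.
  rewrite rnormZ_real ?(ltW c0)//.
  rewrite mulr_natl mulr2n lerD// (le_trans _ Ty)// ler_piMl ?rnorm_ge0//.
exists x => [n|]; first by have [] := xP n.
have H : (fun n => 2 * n.+1%:R^-1 : R) @ \oo --> (0 : R).
  by rewrite -(mulr0 2); apply: cvgMr; exact: cvg_harmonic.
apply: (squeeze_cvgr _ (cvg_cst 0) H); near=> n.
by rewrite rnorm_ge0 /=; have [] := xP n.
Unshelve. all: by end_near. Qed.

Lemma exists_expr_le (r e : R) : 0 <= r -> r < 1 -> 0 < e ->
  exists N, forall n, (N <= n)%N -> r ^+ n <= e.
Proof.
move=> r0 r1 e0.
have /cvgrPdist_le /(_ e e0)[N _ NP] : (fun n => r ^+ n) @ \oo --> (0 : R).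
  by apply: cvg_expr; rewrite ger0_norm.
by exists N => n /NP; rewrite /= sub0r normrN ger0_norm ?exprn_ge0.
Qed.

End bounded_operators.

Section spectrum_of_contractions.
Context {R : realType} (q : R) (q1 : 1 <= q).
Let X := lq q1.
Implicit Type T : bop X X.

(** A solution of [T x - l *: x = y] is a fixed point of
    [x |-> l^-1 *: (T x - y)], which is Lipschitz with constant
    [`|l|^-1 < 1]. *)
Lemma contraction_resolvent_surj T (l : R[i]) : opnorm T <= 1 ->
  1 < Normc.normc l -> forall y, exists x, T x - l *: x = y.
Proof.
move=> T1 l1 y; have l0 : l != 0.
  by apply: contraTneq l1 => ->; rewrite Normc.normc0 ltr10.
set r := Normc.normc l^-1.
have r0 : 0 <= r by exact: normc_ge0.
have r1 : r < 1 by rewrite /r Normc.normcV invf_lt1// (lt_trans ltr01).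
pose f x : X := l^-1 *: (T x - y).
have fB x z : rnorm (f x - f z) <= r * rnorm (x - z).
  rewrite -scalerBr rnormZ opprB addrA subrK -linearB ler_wpM2l//.
  exact: ler_bop.
pose u n := iter n f 0.
(* D solves D = r (D + |y|): the ball of radius D is stable under f *)
pose D := r / (1 - r) * rnorm y.
have D0 : 0 <= D by rewrite mulr_ge0 ?rnorm_ge0// divr_ge0// subr_ge0 ltW.
have uD n : rnorm (u n) <= D.
  elim: n => [|n IH]; first by rewrite rnorm0.
  rewrite [u _.+1]/= /f rnormZ -/r -/(u n).
  have -> : D = r * (D + rnorm y).
    by rewrite /D; field; rewrite subr_eq0 gt_eqF.
  rewrite ler_wpM2l// (le_trans (ler_rnormB _ _))// lerD2r.
  by rewrite (le_trans (ler_bop _ T1)).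
have uC m n : rnorm (u (n + m)%N - u n) <= r ^+ n * D.
  elim: n => [|n IH]; first by rewrite expr0 mul1r subr0.
  by rewrite addSn [u _]/= [u n.+1]/= (le_trans (fB _ _))// exprS -mulrA ler_wpM2l.
have [|x ux] := @lq_cauchy_seq R q q1 u.
  move=> e e0; have D1 : 0 < 2 * (D + 1) by rewrite mulr_gt0// ltr_wpDl.
  have [N NP] := exists_expr_le r0 r1 (divr_gt0 e0 D1).
  have uN n : (N <= n)%N -> rnorm (u n - u N) <= e / 2.
    move/subnKC <-; rewrite (le_trans (uC _ _))//.
    apply: (@le_trans _ _ (e / (2 * (D + 1)) * D)); first by rewrite ler_wpM2r// NP.
    have D1' : 0 < D + 1 by rewrite ltr_wpDl.
    have -> : e / (2 * (D + 1)) * D = e / 2 * (D / (D + 1)).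
      by field; rewrite gt_eqF.
    by rewrite ler_piMr ?divr_ge0 ?(ltW e0)// ler_pdivrMr// mul1r lerDl.
  exists N => m n Nm Nn; rewrite (le_trans (ler_rnorm_distD (u N) _ _))//.
  by rewrite (splitr e) lerD ?uN// rnormC uN.
have fx : f x = x.
  apply/eqP; rewrite -subr_eq0; apply/eqP/rnorm_eq0/eqP.
  rewrite eq_le rnorm_ge0 andbT; apply/ler_addgt0Pr => e e0; rewrite add0r.
  have [N NP] := ux _ (divr_gt0 e0 (ltr0Sn _ 1)).
  rewrite (le_trans (ler_rnorm_distD (u N.+1) _ _))// (splitr e) lerD ?NP//.
  rewrite (le_trans (fB _ _))// rnormC.
  by rewrite (le_trans _ (NP N (leqnn N)))// ler_piMl ?rnorm_ge0// ltW.
exists x; rewrite -[in l *: x]fx /f scalerA mulfV// scale1r.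
by rewrite opprB addrC subrK.
Qed.

(** For [1 < `|l|] the operator [T - l] is bounded below by [`|l| - 1] and onto,
    so its inverse is bounded. *)
Lemma spectrum_contraction T (l : R[i]) : opnorm T <= 1 ->
  spectrum T l -> Normc.normc l <= 1.
Proof.
move=> T1 Tl; rewrite leNgt; apply/negP => l1; apply: Tl.
apply: (@invertible_of_bounded_below _ _ _ (Normc.normc l - 1)).
- by rewrite subr_gt0.
- move=> x; rewrite mulrBl mul1r lerBlDr -rnormZ.
  rewrite -[X in rnorm X](subrK (T x)) (le_trans (ler_rnormD _ _))//.
  by rewrite lerD ?ler_bop// rnormC.
- exact: contraction_resolvent_surj.
Qed.

End spectrum_of_contractions.

(** * Projections, shifts and basis vectors of lq *)

Section coordinate_operators.
Context {R : realType} (q : R) (q1 : 1 <= q).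
Let X := lq q1.
Let q0 : 0 < q. Proof. exact: lt_le_trans q1. Qed.
Implicit Types (u v x : X) (p : pred nat) (s k n N : nat).

(** Partial power sums are additive on vectors with disjoint supports. This is
    what makes block operators contractive, and what makes the norm of a sum of
    two disjoint unit vectors equal to [2 `^ q^-1], less than 2 when [1 < q]. *)
Lemma rnorm_disjointD u v : (forall k, u k = 0 \/ v k = 0) ->
  rnorm (u + v) `^ q = rnorm u `^ q + rnorm v `^ q.
Proof.
move=> uv.
have sumD n : pow_sum q (u + v : X) n = pow_sum q u n + pow_sum q v n.
  rewrite /pow_sum -big_split/=; apply: eq_bigr => k _.
  rewrite -[LHS]/(Normc.normc (u k + v k) `^ q).
  by case: (uv k) => ->; rewrite ?add0r ?addr0 Normc.normc0 powR0 ?gt_eqF// ?add0r ?addr0.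
apply/eqP; rewrite eq_le; apply/andP; split.
  set C := leRHS; have C0 : 0 <= C by rewrite addr_ge0 ?powR_ge0.
  rewrite -(powRKV q0 C0) powR_le ?rnorm_ge0//.
  apply/rnorm_leP => [|n]; first exact: powR_ge0.
  by rewrite powRKV// sumD lerD// pow_sum_le_rnorm.
set C := leRHS.
have uvC m n : pow_sum q u m + pow_sum q v n <= C.
  apply: le_trans (pow_sum_le_rnorm (u + v) (maxn m n)); rewrite sumD.
  by rewrite lerD// nondecreasing_pow_sum ?leq_maxl ?leq_maxr.
have powN_le (w : X) (M : R) : (forall n, pow_sum q w n <= M) -> rnorm w `^ q <= M.
  move=> wM.
  have M0 : 0 <= M by apply: le_trans (wM 0%N); exact: pow_sum_ge0.
  rewrite -(powRKV q0 M0) powR_le ?rnorm_ge0//.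
  by apply/rnorm_leP => [|n]; rewrite ?powR_ge0// powRKV.
rewrite -lerBrDl; apply: (powN_le) => n; rewrite lerBrDl addrC -lerBrDl.
by apply: powN_le => m; rewrite lerBrDl addrC.
Qed.

(** Shifting the coordinates by [s] and erasing those outside [p] covers at once
    the projections and the shifts needed below. *)
Lemma pow_sum_mask p s (x : nat -> R[i]) n :
  pow_sum q (fun k => if p k then x (s + k)%N else 0) n <= pow_sum q x (s + n).
Proof.
elim: n => [|n IH]; first by rewrite {1}/pow_sum big_nil pow_sum_ge0.
rewrite addnS !pow_sumS lerD//; case: ifP => // _.
by rewrite Normc.normc0 powR0 ?powR_ge0 ?gt_eqF.
Qed.

Lemma mask_summable p s x :
  (fun k => if p k then x (s + k)%N else 0) \in q_summable q.
Proof.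
apply: (@bounded_pow_sum_summable _ _ q1 _ (rnorm x `^ q)) => n.
exact: le_trans (pow_sum_mask p s x n) (pow_sum_le_rnorm x _).
Qed.

Definition mask_fun p s x : X := Lq q1 (mask_summable p s x).

Lemma mask_fun_contraction p s x : rnorm (mask_fun p s x) <= rnorm x.
Proof.
apply/rnorm_leP => [|n]; first exact: rnorm_ge0.
exact: le_trans (pow_sum_mask p s x n) (pow_sum_le_rnorm x _).
Qed.

Lemma mask_bounded_linear p s : mask_fun p s \in @bounded_linear R X X.
Proof.
rewrite inE; split; last by exists 1 => x; rewrite mul1r mask_fun_contraction.
move=> a x y; apply/val_inj/funext => k /=.
rewrite -[RHS]/(a * (mask_fun p s x k) + mask_fun p s y k) /=.
by case: ifP => // _; rewrite mulr0 addr0.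
Qed.

Definition coord_mask p s : bop X X := Bop (mask_bounded_linear p s).

Definition proj_head N := coord_mask (fun k => k < N)%N 0.
Definition proj_tail N := coord_mask (fun k => N <= k)%N 0.
(** The backward shift on the coordinates from [N] on, erasing the others. *)
Definition tail_shift N := coord_mask (fun k => N <= k)%N 1.

Lemma ler_coord_mask p s x : rnorm (coord_mask p s x) <= rnorm x.
Proof. exact: mask_fun_contraction. Qed.

Lemma head_tail N x : proj_head N x + proj_tail N x = x.
Proof.
apply/val_inj/funext => k; rewrite -[LHS]/(proj_head N x k + proj_tail N x k) /=.
by case: ltnP; rewrite ?addr0 ?add0r.
Qed.

Lemma rnorm_head_tail N x :
  rnorm x `^ q = rnorm (proj_head N x) `^ q + rnorm (proj_tail N x) `^ q.
Proof.
by rewrite -{1}(head_tail N x) rnorm_disjointD// => k /=; case: ltnP; [right|left].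
Qed.

Lemma tail_shift_tail N x : tail_shift N (proj_tail N x) = tail_shift N x.
Proof.
by apply/val_inj/funext => k /=; case: leqP => // Nk; rewrite leqW.
Qed.

Lemma tail_tail_shift N x : proj_tail N (tail_shift N x) = tail_shift N x.
Proof. by apply/val_inj/funext => k /=; case: leqP. Qed.

(** The power sum of the tail is the difference between a full partial sum and
    the one up to [n], and the latter approaches the supremum. *)
Lemma tail_cvg0 x (e : R) : 0 < e ->
  exists N, forall n, (N <= n)%N -> rnorm (proj_tail n x) <= e.
Proof.
move=> e0; pose E := [set pow_sum q x n | n in [set: nat]].
have supE : has_sup E.
  split; first by exists (pow_sum q x 0), 0%N.
  by exists (rnorm x `^ q) => _ [n _ <-]; exact: pow_sum_le_rnorm.
have [_ [N _ <-] NE] := sup_adherent (powR_gt0 q e0) supE.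
exists N => n Nn; apply/rnorm_leP => [|m]; first exact: ltW.
have tailE k : pow_sum q (proj_tail n x) k + pow_sum q x (minn k n) = pow_sum q x k.
  elim: k => [|k IH]; first by rewrite min0n /pow_sum !big_nil addr0.
  rewrite (pow_sumS _ (proj_tail n x)) (pow_sumS _ x) -IH /=; case: leqP => nk.
    by rewrite (minn_idPr (leqW nk)) addrAC.
  rewrite (minn_idPl nk) pow_sumS.
  by rewrite Normc.normc0 powR0 ?gt_eqF// addr0 addrA.
apply: le_trans (nondecreasing_pow_sum _ _ (leq_maxl m n)) _.
rewrite -(lerD2r (pow_sum q x n)).
rewrite -[X in _ + pow_sum q x X <= _](minn_idPr (leq_maxr m n)).
rewrite tailE -lerBlDl.
apply: (@le_trans _ _ (sup E - e `^ q)).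
  by rewrite lerD2r; apply: sup_ubound; [have [] := supE|exists (maxn m n)].
exact: le_trans (ltW NE) (nondecreasing_pow_sum _ _ Nn).
Qed.

Lemma pow_sum_delta j n :
  pow_sum q (fun k => (k == j)%:R : R[i]) n = (j < n)%:R.
Proof.
elim: n => [|n IH]; first by rewrite /pow_sum big_nil.
rewrite pow_sumS IH ltnS normc_nat; case: (ltngtP n j) => _ /=.
- by rewrite powR0 ?gt_eqF// addr0.
- by rewrite powR0 ?gt_eqF// addr0.
- by rewrite powR1 add0r.
Qed.

Lemma delta_summable j : (fun k => (k == j)%:R : R[i]) \in q_summable q.
Proof.
apply: (@bounded_pow_sum_summable _ _ q1 _ 1) => n.
by rewrite pow_sum_delta; case: (_ < _)%N.
Qed.

Definition basis_vector j : X := Lq q1 (delta_summable j).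

Lemma rnorm_basis j : rnorm (basis_vector j) = 1.
Proof.
apply/eqP; rewrite eq_le; apply/andP; split.
  by apply/rnorm_leP => // n; rewrite pow_sum_delta powR1; case: (_ < _)%N.
by have := normc_coord_le (basis_vector j) j; rewrite /= eqxx Normc.normc1.
Qed.

Lemma head_basis N j : (j < N)%N -> proj_head N (basis_vector j) = basis_vector j.
Proof.
move=> jN; apply/val_inj/funext => k /=; rewrite add0n.
by case: eqVneq => [->|]; rewrite ?jN// if_same.
Qed.

Lemma head_basis0 N j : (N <= j)%N -> proj_head N (basis_vector j) = 0.
Proof.
move=> Nj; apply/val_inj/funext => k /=; rewrite add0n.
by case: eqVneq => [->|]; rewrite ?if_same// ltnNge Nj.
Qed.

Lemma tail_shift_basis0 N j : (j <= N)%N -> tail_shift N (basis_vector j) = 0.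
Proof.
move=> jN; apply/val_inj/funext => k /=; case: leqP => // Nk.
by rewrite add1n gtn_eqF// ltnS (leq_trans jN).
Qed.

Lemma tail_shift_basisS N j : (N <= j)%N ->
  tail_shift N (basis_vector j.+1) = basis_vector j.
Proof.
move=> Nj; apply/val_inj/funext => k /=; rewrite add1n eqSS.
by case: eqVneq => [->|]; rewrite ?Nj// if_same.
Qed.

Lemma head_sum_basis N x : proj_head N x = \sum_(0 <= k < N) x k *: basis_vector k.
Proof.
elim: N => [|N IH]; first by rewrite big_nil; apply/val_inj/funext.
rewrite big_nat_recr//= -IH; apply/val_inj/funext => k.
rewrite -[RHS]/(proj_head N x k + x N * (k == N)%:R) /= ltnS leq_eqVlt.
by case: eqVneq => [->|]/=; rewrite ?ltnn ?add0r ?mulr1// mulr0 addr0.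
Qed.

End coordinate_operators.

(** * Open conditions that force the typical properties *)

Section shift_like_operators.
Context {R : realType} (q : R) (q1 : 1 <= q).
Let X := lq q1.
Local Notation b j := (@basis_vector R q q1 j%N).
Implicit Type T : bop X X.

Definition agrees T n (d : R) (a c : nat -> X) :=
  forall i, (i < n)%N -> rnorm (T (a i) - c i) < d.

(** Up to [d], the operator acts on [k.+1] consecutive basis vectors as the
    backward shift on a finite chain: the first vector goes to 0, each other one
    to its predecessor. *)
Definition shift_like k (d : R) : set (bop X X) := [set T | exists N,
  agrees T k.+1 d (fun i => b (N + i))
    (fun i => if i is j.+1 then b (N + j) else 0)].

(** A pseudo-orbit of [x], with errors below [d], that ends near 0. The operator
    is only evaluated at finitely many fixed vectors, which makes the condition
    open; iterates of the operator would not obviously do, being strongly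
    continuous only on bounded sets. The term [n%:R * d] bounds the accumulated
    error of a contraction. *)
Definition vanishing_orbit (x : X) (e : R) : set (bop X X) :=
  [set T | exists n d y, [/\ y 0%N = x, n%:R * d + rnorm (y n) < e &
    agrees T n d y (fun i => y i.+1)]].

Lemma shift_like_le T k k' d d' : (k <= k')%N -> d' <= d ->
  shift_like k' d' T -> shift_like k d T.
Proof.
move=> kk' dd' [N TN]; exists N => i ik.
by apply: lt_le_trans dd'; apply: TN; exact: leq_trans ik _.
Qed.

Lemma shift_like_all T : (forall k, shift_like k k.+1%:R^-1 T) ->
  forall k d, 0 < d -> shift_like k d T.
Proof.
move=> Tk k d d0; have [m _ mP] := near_infty_natSinv_lt (PosNum d0).
apply: (shift_like_le (leq_maxl k m) _ (Tk _)).
by apply: ltW; apply: mP => /=; exact: leq_maxr.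
Qed.

(** A unit vector is sent close to another unit vector. *)
Lemma shift_like_opnorm T : (forall d, 0 < d -> shift_like 1 d T) ->
  1 <= opnorm T.
Proof.
move=> TS; apply/ler_addgt0Pr => d /TS[N /(_ 1%N isT)/=]; rewrite addn0 => TN.
rewrite -(rnorm_basis q1 N) -[b N](subKr (T (b (N + 1)))).
rewrite (le_trans (ler_rnormB _ _))// lerD// ?(ltW TN)//.
by rewrite (le_trans (le_opnorm _ _))// rnorm_basis mulr1.
Qed.

(** The vector is the truncated geometric series with terms
    [l ^+ i *: b (N + i)]: for an exact shift all terms of [T x - l *: x] cancel
    but the last, of norm [`|l| ^+ k.+1]. Its coordinate [N] is 1, which bounds
    its norm from below. *)
Lemma shift_like_eigenvector T k d l : shift_like k d T -> Normc.normc l <= 1 ->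
  exists2 x : X, 1 <= rnorm x &
    rnorm (T x - l *: x) <= k.+1%:R * d + Normc.normc l ^+ k.+1.
Proof.
move=> [N TN] l1.
suff [x [xN xk Tx]] : exists x : X, [/\ x N = 1,
    forall i, (N + k < i)%N -> x i = 0 &
    rnorm (T x - l *: x + l ^+ k.+1 *: b (N + k)) <= k.+1%:R * d].
  exists x; first by rewrite -[leLHS]Normc.normc1 -xN normc_coord_le.
  rewrite -[X in rnorm X](addrK (l ^+ k.+1 *: b (N + k))).
  rewrite (le_trans (ler_rnormB _ _))// lerD//.
  by rewrite rnormZ rnorm_basis mulr1 normcX.
elim: k TN => [|k IH] TN.
  exists (b N); split=> [|i|]; first by rewrite /= eqxx.
    by rewrite addn0 /= => /gtn_eqF ->.
  rewrite addn0 expr1 subrK mul1r ltW//.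
  by have := TN 0%N isT; rewrite /= addn0 subr0.
have [i ik|x [xN xk Tx]] := IH; first by apply: TN; exact: leqW.
exists (x + l ^+ k.+1 *: b (N + k.+1)); split=> [|i Ni|].
- rewrite -[LHS]/(x N + l ^+ k.+1 * (N == N + k.+1)%N%:R) xN.
  by rewrite ltn_eqF ?mulr0 ?addr0// -addSnnS leq_addr.
- rewrite -[LHS]/(x i + l ^+ k.+1 * (i == N + k.+1)%N%:R).
  rewrite gtn_eqF// mulr0 addr0 xk//; apply: leq_trans Ni.
  by rewrite addnS leqW.
- set w := (X in rnorm X); have -> : w = (T x - l *: x + l ^+ k.+1 *: b (N + k)) +
      l ^+ k.+1 *: (T (b (N + k.+1)) - b (N + k)).
    rewrite /w linearD linearZ/= scalerDr scalerBr scalerA -exprS.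
    rewrite opprD !addrA subrK; set z := l ^+ k.+1 *: b (N + k).
    by rewrite (addrAC _ z) addrK addrAC.
  rewrite (le_trans (ler_rnormD _ _))// -[k.+2%:R]natr1 mulrDl mul1r lerD//.
  rewrite rnormZ normcX (le_trans _ (ltW (TN k.+1 (ltnSn _))))//.
  by rewrite ler_piMl ?rnorm_ge0// exprn_ile1 ?normc_ge0.
Qed.

(** On the unit circle the remainder [`|l| ^+ k.+1] does not vanish, so [l] is
    approached from inside the disk. *)
Lemma shift_like_ap_spectrum T l : opnorm T <= 1 ->
  (forall k d, 0 < d -> shift_like k d T) -> Normc.normc l <= 1 ->
  ap_spectrum T l.
Proof.
move=> T1 TS l1; apply: ap_spectrum_approx => // e e0.
have [e' [e'0 e'1 e'e]] : exists e', [/\ 0 < e', e' < 1 & e' <= e].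
  exists (Num.min (1 / 2) e); split.
  - by rewrite lt_min e0 divr_gt0.
  - by rewrite gt_min ltr_pdivrMr// mul1r ltr1n.
  - by rewrite ge_min lexx orbT.
pose l' := (1 - e')%:C%C * l.
have c0 : 0 <= 1 - e' by rewrite subr_ge0 ltW.
have l'1 : Normc.normc l' < 1.
  rewrite Normc.normcM normc_real// (@le_lt_trans _ _ (1 - e'))// ?ler_piMr//.
  by rewrite gtrBl.
have [N NP] := exists_expr_le (normc_ge0 l') l'1 (divr_gt0 e0 (ltr0Sn _ 1)).
have [|x x1 Tx] := @shift_like_eigenvector T N (e / 2 / N.+1%:R) l' _ (ltW l'1).
  by apply: TS; rewrite !divr_gt0.
exists l', x; split=> //.
  have -> : l' - l = (- (e'%:C)%C) * l.
    by rewrite /l' rmorphB rmorph1 mulrBl mul1r addrAC subrr add0r mulNr.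
  rewrite Normc.normcM [Normc.normc (- _)]normcN normc_real ?(ltW e'0)//.
  by rewrite (le_trans _ e'e)// ler_piMr// ltW.
rewrite (le_trans Tx)// [leRHS](splitr e) lerD//; last by rewrite NP.
by rewrite mulrC divfK ?pnatr_eq0.
Qed.

Lemma iter_contraction_le T x m n : opnorm T <= 1 -> (m <= n)%N ->
  rnorm (iter n T x) <= rnorm (iter m T x).
Proof.
move=> T1 /subnK <-; elim: (n - m)%N => [//|k IH].
by rewrite addSn iterS (le_trans (ler_bop _ T1)).
Qed.

Lemma vanishing_orbit_iter T x e : opnorm T <= 1 -> vanishing_orbit x e T ->
  exists N, forall n, (N <= n)%N -> rnorm (iter n T x) <= e.
Proof.
move=> T1 [N [d [y [<- Ne Ty]]]]; exists N => n Nn.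
rewrite (le_trans (iter_contraction_le _ T1 Nn))// (le_trans _ (ltW Ne))//.
rewrite -lerBlDr; apply: (@le_trans _ _ (rnorm (iter N T (y 0%N) - y N))).
  by rewrite lerBlDr -[X in rnorm X](subrK (y N)) ler_rnormD.
elim: N {Nn Ne} Ty => [|N IH] Ty; first by rewrite subrr rnorm0 mul0r.
rewrite iterS (le_trans (ler_rnorm_distD (T (y N)) _ _))//.
rewrite -[N.+1%:R]natr1 mulrDl mul1r lerD ?(ltW (Ty N (ltnSn N)))//.
rewrite -linearB (le_trans (ler_bop _ T1))// IH// => i iN.
by apply: Ty; exact: leqW.
Qed.

(** The orbits under a contraction that tend to 0 start from a closed linear
    subspace, here one that contains all the basis vectors. *)
Lemma vanishing_orbits T : opnorm T <= 1 ->
  (forall j e, 0 < e -> vanishing_orbit (b j) e T) ->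
  forall x, rnorm (iter n T x) @[n --> \oo] --> (0 : R).
Proof.
move=> T1 Tb x.
have iter_lin n : linear (iter n T).
  by elim: n => [|n IH] a y z //; rewrite !iterS IH linearP.
have Thead N e : 0 < e ->
    exists M, forall n, (M <= n)%N -> rnorm (iter n T (proj_head q1 N x)) <= e.
  elim: N e => [|N IH] e e0.
    exists 0%N => n _; rewrite head_sum_basis big_nil.
    rewrite (le_trans (iter_contraction_le _ T1 (leq0n n)))// rnorm0 ltW//.
  have e20 : 0 < e / 2 by rewrite divr_gt0.
  have c0 : 0 < Normc.normc (x N) + 1 by rewrite ltr_wpDl ?normc_ge0.
  have [M MP] := IH _ e20.
  have [M' M'P] := vanishing_orbit_iter T1 (Tb N _ (divr_gt0 e20 c0)).
  exists (maxn M M') => n; rewrite geq_max => /andP[Mn M'n].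
  rewrite head_sum_basis big_nat_recr//= -head_sum_basis addrC iter_lin.
  rewrite (le_trans (ler_rnormD _ _))// (splitr e) addrC lerD ?MP// rnormZ.
  apply: (@le_trans _ _ (Normc.normc (x N) * (e / 2 / (Normc.normc (x N) + 1)))).
    by rewrite ler_wpM2l ?normc_ge0// M'P.
  by rewrite mulrCA ler_piMr ?(ltW e20)// ler_pdivrMr// mul1r lerDl.
apply/cvgrPdist_le => e e0; have e20 : 0 < e / 2 by rewrite divr_gt0.
have [N NP] := tail_cvg0 x e20; have [M MP] := Thead N _ e20.
exists M => // n /= Mn; rewrite sub0r normrN ger0_norm ?rnorm_ge0//.
rewrite -(head_tail N x) -[proj_head q1 N x]scale1r iter_lin scale1r.
rewrite (le_trans (ler_rnormD _ _))// (splitr e) lerD ?MP//.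
by rewrite (le_trans (iter_contraction_le _ T1 (leq0n n)))// NP.
Qed.

Lemma closure_unit_disk (l : R[i]) :
  closure (unit_disk R) l <-> Normc.normc l <= 1.
Proof.
have rnormc (z : R[i]^o) : rnorm z = Normc.normc z by case: z.
have diskE (z : R[i]) : unit_disk R z <-> Normc.normc z < 1.
  by rewrite /unit_disk/= -[`|z|]/(Normc.normc z)%:C%C ltcR.
have nearP (e : R) : 0 < e -> nbhs (l : R[i]^o) [set z : R[i]^o | rnorm (z - l) < e].
  by have /cvg_rnormP := @cvg_id _ (nbhs (l : R[i]^o)); apply.
split=> [lD|l1].
  apply/ler_addgt0Pr => e e0.
  have [z [/diskE z1]] := lD _ (nearP e e0); rewrite /= rnormc => zl.
  have -> : l = z + - (z - l) by rewrite opprB addrC subrK.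
  rewrite (le_trans (ler_normcD _ _))// [Normc.normc (- _)]normcN.
  by rewrite lerD// ltW.
move=> B; rewrite -nbhs_ballE => -[[e e'] /=].
rewrite ltcE/= => /andP[/eqP e'0 e0] lB.
pose c : R := Num.min (1 / 2) (e / 2).
have c0 : 0 < c by rewrite lt_min !divr_gt0.
have c1 : c < 1 by rewrite gt_min ltr_pdivrMr// mul1r ltr1n.
have ce : c < e.
  by rewrite gt_min orbC ltr_pdivrMr// ltr_pMr// ltr1n.
exists ((1 - c)%:C%C * l); split.
  apply/diskE; rewrite Normc.normcM normc_real ?subr_ge0 ?(ltW c1)//.
  by rewrite (@le_lt_trans _ _ (1 - c))// ?ler_piMr ?subr_ge0 ?(ltW c1)// gtrBl.
apply: lB; rewrite /ball/= -[X in X < _]/(Normc.normc (l - (1 - c)%:C%C * l))%:C%C.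
have -> : l - (1 - c)%:C%C * l = c%:C%C * l.
  by rewrite rmorphB rmorph1 mulrBl mul1r opprB addrCA subrr addr0.
rewrite Normc.normcM normc_real ?(ltW c0)// ltcE/= -e'0 eqxx/=.
by rewrite (le_lt_trans _ ce)// ler_piMr// ltW.
Qed.

(** Everything about the spectrum follows from the inclusions of the
    approximate point spectrum in the spectrum, of the spectrum in the closed
    disk, and of the closed disk in the approximate point spectrum. In
    particular 0 is a spectral value, so [T] is not invertible. *)
Theorem shift_like_typical_properties T : opnorm T <= 1 ->
  (forall k, shift_like k k.+1%:R^-1 T) ->
  (forall j k, vanishing_orbit (b j) k.+1%:R^-1 T) ->
  typical_properties q1 T.
Proof.
move=> T1 /shift_like_all TS TO.
have spE : spectrum T `<=` [set l | Normc.normc l <= 1].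
  by move=> l; exact: spectrum_contraction.
have apE : [set l | Normc.normc l <= 1] `<=` ap_spectrum T.
  by move=> l; exact: shift_like_ap_spectrum.
have spdE : spectrum T = closure (unit_disk R).
  apply/seteqP; split=> l; first by move/spE/closure_unit_disk.
  by move/closure_unit_disk/apE/ap_spectrum_spectrum.
split.
- apply/eqP; rewrite eq_le T1 shift_like_opnorm// => d; exact: TS.
- apply: vanishing_orbits => // j e e0.
  have [m _ mP] := near_infty_natSinv_lt (PosNum e0).
  have [n [d [y [y0 nd Ty]]]] := TO j m.
  by exists n, d, y; split=> //; apply: lt_trans nd (mP m (leqnn m)).
- have n0 : Normc.normc (0 : R[i]) <= 1 by rewrite Normc.normc0.
  have : spectrum T 0 by exact: ap_spectrum_spectrum (apE 0 n0).
  by rewrite /spectrum/= scale0r subr0.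
- split=> //; apply/seteqP; split; first exact: ap_spectrum_spectrum.
  by move=> l /spE/apE.
Qed.

End shift_like_operators.

(** * A dense family of operators satisfying the open conditions *)

Section approximants.
Context {R : realType} (q : R) (q1 : 1 <= q).
Let X := lq q1.
Let q0 : 0 < q. Proof. exact: lt_le_trans q1. Qed.
Local Notation b j := (@basis_vector R q q1 j%N).
Local Notation P := (proj_head q1).
Local Notation Q := (proj_tail q1).
Local Notation S := (tail_shift q1).
Implicit Type T : bop X X.

Definition ratio N : R := 1 - N.+1%:R^-1.

Lemma ratio_ge0 N : 0 <= ratio N.
Proof. by rewrite subr_ge0 invf_le1// ler1n. Qed.

Lemma ratio_lt1 N : ratio N < 1.
Proof. by rewrite gtrBl invr_gt0. Qed.

(** The compression of [T] to the first [N] coordinates, next to a backward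
    shift on the remaining ones. The factor [ratio N < 1] makes the orbits in
    the finite block vanish, and tends to 1. *)
Definition approximant T N : bop X X :=
  (ratio N)%:C%C *: bop_comp (P N) (bop_comp T (P N)) + S N.

Lemma approximantE T N x :
  approximant T N x = (ratio N)%:C%C *: P N (T (P N x)) + S N x.
Proof. by []. Qed.

Lemma approximant_positive T N :
  positive_operator T -> positive_operator (approximant T N).
Proof.
move=> posT x x0 k.
have P0 y : positive_vector y -> positive_vector (P N y).
  by move=> y0 j /=; case: ifP.
rewrite -[X in 0 <= X]/((ratio N)%:C%C * P N (T (P N x)) k + S N x k).
rewrite addr_ge0//; last by rewrite /=; case: ifP.
by rewrite mulr_ge0 ?lecR ?ratio_ge0//; exact/P0/posT/P0.
Qed.

Lemma approximant_contraction T N :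
  opnorm T <= 1 -> opnorm (approximant T N) <= 1.
Proof.
move=> T1; apply: opnorm_le => // x; rewrite mul1r.
apply: (powR_le_inj q0); rewrite ?rnorm_ge0// approximantE rnorm_disjointD.
  rewrite (rnorm_head_tail N x) lerD// powR_le ?rnorm_ge0//.
    rewrite rnormZ_real ?ratio_ge0// (@le_trans _ _ (rnorm (P N (T (P N x)))))//.
      by rewrite ler_piMl ?rnorm_ge0// ltW// ratio_lt1.
    by rewrite (le_trans (ler_coord_mask _ _ _))// ler_bop.
  by rewrite -tail_shift_tail ler_coord_mask.
move=> k; rewrite -[X in X = 0 \/ _]/((ratio N)%:C%C * P N (T (P N x)) k) /=.
by case: ltnP; [right|left; rewrite mulr0].
Qed.

Lemma approximant_basis0 T N : approximant T N (b N) = 0.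
Proof.
by rewrite approximantE head_basis0// !linear0 ?scaler0 tail_shift_basis0// addr0.
Qed.

Lemma approximant_basisS T N i :
  approximant T N (b (N + i.+1)) = b (N + i).
Proof.
rewrite approximantE head_basis0 ?leq_addr// !linear0 ?scaler0 add0r.
by rewrite addnS tail_shift_basisS// leq_addr.
Qed.

Lemma approximant_shift_like T N k d : 0 < d ->
  shift_like k d (approximant T N).
Proof.
move=> d0; exists N => -[|i] _.
  by rewrite addn0 approximant_basis0 subr0 rnorm0.
by rewrite approximant_basisS subrr rnorm0.
Qed.

(** A basis vector of the shifted block is killed after finitely many steps; one
    of the finite block stays there, and shrinks by [ratio N] at each step. *)
Lemma approximant_iter_cvg0 T N j e : opnorm T <= 1 -> 0 < e ->
  exists n, rnorm (iter n (approximant T N) (b j)) < e.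
Proof.
move=> T1 e0; set A := approximant T N.
have [jN|/subnKC <-] := ltnP j N; last first.
  elim: (j - N)%N => [|i [n IH]].
    by exists 1%N; rewrite addn0 -[iter _ _ _]/(A (b N)) /A approximant_basis0 rnorm0.
  by exists n.+1; rewrite iterSr /A approximant_basisS.
have AP x : P N x = x -> P N (A x) = A x /\ rnorm (A x) <= ratio N * rnorm x.
  move=> Px; have Sx : S N x = 0.
    apply/val_inj/funext => k /=; case: leqP => // Nk.
    by rewrite -Px /= add1n ltnNge leqW.
  rewrite /A approximantE Px Sx addr0; split.
    rewrite linearZ; congr (_ *: _); apply/val_inj/funext => k /=.
    by rewrite !add0n; case: ifP => // ->.
  rewrite rnormZ_real ?ratio_ge0// ler_wpM2l ?ratio_ge0//.
  by rewrite (le_trans (ler_coord_mask _ _ _))// ler_bop.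
have iterA n : P N (iter n A (b j)) = iter n A (b j) /\
    rnorm (iter n A (b j)) <= ratio N ^+ n.
  elim: n => [|n [IHP IHn]]; first by rewrite head_basis// rnorm_basis.
  rewrite iterS; have [-> An] := AP _ IHP; split=> //.
  by rewrite (le_trans An)// exprS ler_wpM2l ?ratio_ge0.
have [n nP] := exists_expr_le (ratio_ge0 N) (ratio_lt1 N) (divr_gt0 e0 (ltr0Sn _ 1)).
exists n; apply: (@le_lt_trans _ _ (e / 2)); last first.
  by rewrite ltr_pdivrMr// ltr_pMr// ltr1n.
by rewrite (le_trans (iterA n).2)// nP.
Qed.

Lemma approximant_vanishing_orbit T N j e : opnorm T <= 1 -> 0 < e ->
  vanishing_orbit (b j) e (approximant T N).
Proof.
move=> T1 e0; have e20 : 0 < e / 2 by rewrite divr_gt0.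
have [n nP] := approximant_iter_cvg0 N j T1 e20.
exists n, (e / 2 / n.+1%:R), (fun i => iter i (approximant T N) (b j)).
split=> //; last by move=> i _; rewrite iterS subrr rnorm0 !divr_gt0.
rewrite [ltRHS](splitr e) ler_ltD// mulrCA ler_piMr ?(ltW e20)//.
by rewrite ler_pdivrMr// mul1r ler_nat.
Qed.

(** Each term but the first contains a tail projection, placed so that both
    convergences can be read off. Strongly, the term [Q N (T x)] is a tail of
    [T x], and the next ones are bounded by the tail of [x]. After composition
    with a functional [phi], each of them contains either [phi] composed with
    [Q N] or the functional [phi] composed with [T], then with [Q N]. *)
Lemma approximant_sub T N x : approximant T N x - T x =
  - ((N.+1%:R^-1)%:C%C *: P N (T (P N x))) - Q N (T x) + Q N (T (Q N x))
  - T (Q N x) + Q N (S N x).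
Proof.
rewrite approximantE tail_tail_shift.
have -> : T (P N x) = T x - T (Q N x) by rewrite -linearB -{2}(head_tail N x) addrK.
set y := T x; set z := T (Q N x); set w := S N x.
apply/val_inj/funext => k.
rewrite -[LHS]/((ratio N)%:C%C * P N (y - z) k + w k - y k).
rewrite -[RHS]/(- ((N.+1%:R^-1)%:C%C * P N (y - z) k) - Q N y k + Q N z k - z k + w k).
have -> : P N (y - z) k = if (k < N)%N then y k - z k else 0 by [].
have -> : Q N y k = if (N <= k)%N then y k else 0 by [].
have -> : Q N z k = if (N <= k)%N then z k else 0 by [].
rewrite /ratio rmorphB rmorph1.
case: ltnP => kN; last by ring.
have -> : w k = 0 by rewrite /w /= leqNgt kN.
by ring.
Qed.

End approximants.

(** * Functionals on lq are small far away when q > 1 *)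

Section dual_tails.
Context {R : realType} (q : R) (q1 : 1 <= q).
Let X := lq q1.
Let q0 : 0 < q. Proof. exact: lt_le_trans q1. Qed.
Local Notation P := (proj_head q1).
Local Notation Q := (proj_tail q1).
Implicit Types (phi : dual X) (a e : R).

Lemma rnorm_scalar (z : R[i]^o) : rnorm z = Normc.normc z.
Proof. by case: z. Qed.

Lemma exists_near_opnorm (V W : normedModType R[i]) (B : bop V W) a :
  a < opnorm B -> exists2 x, rnorm x <= 1 & a < rnorm (B x).
Proof.
move=> aB; have aB0 : 0 < opnorm B - a by rewrite subr_gt0.
have [_ [x /= x1 <-]] := sup_adherent aB0 (opnorm_has_sup B).
by rewrite -/(opnorm B) subKr => Bx; exists x.
Qed.

(** A functional almost attains its norm on the tail at a vector of finite
    support; a rotation makes its value there a positive real, so that values on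
    several blocks add up without cancellation. *)
Lemma exists_block phi n a : 0 <= a -> a < opnorm (bop_comp phi (Q n)) ->
  exists M (x : X) (t : R), [/\ rnorm x <= 1, phi x = t%:C%C, a < t &
    forall k, (k < n)%N || (M <= k)%N -> x k = 0].
Proof.
move=> a0 /exists_near_opnorm[x0 x01]; set y := Q n x0.
rewrite -[X in a < X]/(rnorm (phi y)) => ay.
have y1 : rnorm y <= 1 by rewrite (le_trans (ler_coord_mask _ _ _)).
have c0 : 0 < opnorm phi + 1 by rewrite ltr_wpDl ?opnorm_ge0.
have g0 : 0 < rnorm (phi y) - a by rewrite subr_gt0.
have [M /(_ M (leqnn M)) MP] := tail_cvg0 y (divr_gt0 g0 c0).
have aPy : a < rnorm (phi (P M y)).
  have : rnorm (phi y) <= rnorm (phi (P M y)) + rnorm (phi (Q M y)).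
    by rewrite -{1}(head_tail M y) linearD ler_rnormD.
  have : rnorm (phi (Q M y)) < rnorm (phi y) - a.
    apply: le_lt_trans (le_opnorm _ _) _.
    apply: (@le_lt_trans _ _ (opnorm phi * ((rnorm (phi y) - a) / (opnorm phi + 1)))).
      by rewrite ler_wpM2l ?opnorm_ge0.
    by rewrite mulrCA gtr_pMr// ltr_pdivrMr// mul1r ltrDl.
  by lra.
set w : R[i] := phi (P M y); have nw : 0 < Normc.normc w.
  by rewrite (le_lt_trans a0)// -rnorm_scalar.
have w0 : w != 0 by apply: contraTneq nw => ->; rewrite Normc.normc0 ltxx.
exists M, (((Normc.normc w)%:C%C / w) *: P M y), (Normc.normc w); split.
- rewrite rnormZ Normc.normcM normc_real ?normc_ge0// Normc.normcV mulfV ?gt_eqF//.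
  by rewrite mul1r (le_trans (ler_coord_mask _ _ _)).
- by rewrite linearZ/= -[LHS]/((Normc.normc w)%:C%C / w * w) divfK.
- by rewrite -rnorm_scalar.
move=> k kn; rewrite -[LHS]/((Normc.normc w)%:C%C / w * P M y k).
case/orP: kn => kn /=; rewrite ?add0n; last by rewrite ltnNge kn mulr0.
by rewrite (leqNgt n) kn if_same mulr0.
Qed.

Lemma dual_tail_le phi m n : (m <= n)%N ->
  opnorm (bop_comp phi (Q n)) <= opnorm (bop_comp phi (Q m)).
Proof.
move=> mn; apply: opnorm_le => [|x]; first exact: opnorm_ge0.
have -> : bop_comp phi (Q n) x = bop_comp phi (Q m) (Q n x).
  rewrite /=; congr (phi _); apply/val_inj/funext => k /=; rewrite !add0n.
  by case: (leqP n k) => [/(leq_trans mn) ->|]; rewrite ?if_same.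
by rewrite (le_trans (le_opnorm _ _))// ler_wpM2l ?opnorm_ge0// ler_coord_mask.
Qed.

(** Let [L] be the infimum of the norms of [phi] on the tails, and assume
    [0 < L]. In a tail where the norm of [phi] is almost [L], there are two
    vectors of norm at most 1, with disjoint supports, at which [phi] takes
    values almost [L]. Their sum has norm at most [2 `^ q^-1] and value almost
    [2 * L], so [2 * L <= 2 `^ q^-1 * L], which is absurd when [1 < q]. *)
Lemma dual_tail_cvg0 phi e : 1 < q -> 0 < e ->
  exists N, forall n, (N <= n)%N -> opnorm (bop_comp phi (Q n)) <= e.
Proof.
move=> lt1q e0.
pose d n := opnorm (bop_comp phi (Q n)).
pose L := inf (range d).
have infd : has_inf (range d).
  by split; [exists (d 0%N), 0%N|exists 0 => _ [n _ <-]; exact: opnorm_ge0].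
have Ld n : L <= d n by apply: ge_inf; [have [] := infd|exists n].
have L0 : 0 <= L.
  by apply: lb_le_inf; [have [] := infd|move=> _ [n _ <-]; exact: opnorm_ge0].
suff L_le0 : L <= 0.
  have [_ [N _ <-]] := inf_adherent e0 infd; rewrite -/L => dN.
  exists N => n /dual_tail_le/le_trans; apply; rewrite -/(d N) ltW//.
  by rewrite (lt_le_trans dN)// gerDr.
rewrite leNgt; apply/negP => Lgt0.
pose c : R := 2 `^ q^-1.
have c0 : 0 <= c by exact: powR_ge0.
have c2 : c < 2.
  rewrite /c -[ltRHS](@powRr1 _ 2)// /powR pnatr_eq0/= ltr_expR.
  by rewrite ltr_pM2r ?ln_gt0 ?ltr1n// invf_lt1.
(* chosen so that h < L and (L + h) * c < 2 * (L - h) *)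
pose h := L * (2 - c) / (2 * (2 + c)).
have c20 : 0 < 2 * (2 + c) by lra.
have h0 : 0 < h by rewrite divr_gt0// mulr_gt0// subr_gt0.
have hE : h * (2 * (2 + c)) = L * (2 - c) by rewrite divfK ?gt_eqF.
have hL : h < L by rewrite ltr_pdivrMr// ltr_pM2l//; lra.
have Lh0 : 0 <= L - h by rewrite subr_ge0 ltW.
have Lhd n : L - h < d n by rewrite (lt_le_trans _ (Ld n))// gtrBl.
have [_ [N _ <-]] := inf_adherent h0 infd; rewrite -/L => dN.
have [M [x [t [x1 xt ht x0]]]] := exists_block Lh0 (Lhd N).
have [M' [y [s [y1 ys hs y0]]]] := exists_block Lh0 (Lhd (maxn N M)).
have xyc : rnorm (x + y) <= c.
  apply: (powR_le_inj q0); rewrite ?rnorm_ge0// powRKV// rnorm_disjointD.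
    have le1 (z : X) : rnorm z <= 1 -> rnorm z `^ q <= 1.
      by move=> z1; have := powR_le q0 (rnorm_ge0 z) z1; rewrite powR1.
    by have := lerD (le1 x x1) (le1 y y1).
  move=> k; case: (leqP M k) => Mk; first by left; apply: x0; rewrite Mk orbT.
  by right; apply: y0; rewrite leq_max Mk orbT.
have QN : Q N (x + y) = x + y.
  apply/val_inj/funext => k /=; case: leqP => // kN.
  rewrite -[RHS]/(x k + y k) x0 ?kN// y0 ?addr0//.
  by rewrite leq_max kN.
have : rnorm (phi (x + y)) <= d N * rnorm (x + y).
  by rewrite -{1}QN; exact: (le_opnorm (bop_comp phi (Q N))).
rewrite linearD/= xt ys -[X in rnorm X]/(t%:C%C + s%:C%C) -rmorphD rnorm_scalar.
rewrite normc_real; last by lra.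
have : d N * rnorm (x + y) <= (L + h) * c.
  by rewrite ler_pM ?opnorm_ge0 ?rnorm_ge0// ltW.
nra.
Qed.

End dual_tails.

(** * Convergence of the approximants *)

Section approximant_convergence.
Context {R : realType} (q : R) (q1 : 1 <= q).
Let X := lq q1.
Implicit Type T : bop X X.

Lemma ler_rnorm5 (V : normedModType R[i]) (a b c d f : V) :
  rnorm (- a - b + c - d + f) <=
  rnorm a + rnorm b + rnorm c + rnorm d + rnorm f.
Proof.
rewrite -(rnormN a) (le_trans (ler_rnormD _ _))// lerD2r.
rewrite (le_trans (ler_rnormB _ _))// lerD2r.
rewrite (le_trans (ler_rnormD _ _))// lerD2r.
exact: ler_rnormB.
Qed.

Lemma exists_invn_mul_le (M e : R) : 0 <= M -> 0 < e ->
  exists N, forall n, (N <= n)%N -> n.+1%:R^-1 * M <= e.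
Proof.
move=> M0 e0; have M1 : 0 < M + 1 by rewrite ltr_wpDl.
have [N _ NP] := near_infty_natSinv_lt (PosNum (divr_gt0 e0 M1)).
exists N => n /NP /ltW /= nP.
apply: (@le_trans _ _ (e / (M + 1) * M)); first by rewrite ler_wpM2r.
by rewrite mulrAC -mulrA ler_piMr ?(ltW e0)// ler_pdivrMr// mul1r lerDl.
Qed.

Lemma approximant_cvg T x : opnorm T <= 1 ->
  approximant T n x @[n --> \oo] --> T x.
Proof.
move=> T1; apply/cvg_rnormP => e e0; have e60 : 0 < e / 6 by rewrite divr_gt0.
have [N1 N1P] := exists_invn_mul_le (rnorm_ge0 x) e60.
have [N2 N2P] := tail_cvg0 x e60.
have [N3 N3P] := tail_cvg0 (T x) e60.
exists (maxn N1 (maxn N2 N3)) => // n /=; rewrite !geq_max => /and3P[n1 n2 n3].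
rewrite approximant_sub (le_lt_trans (ler_rnorm5 _ _ _ _ _))//.
have := N1P n n1; have := N2P n n2; have := N3P n n3.
set Q := proj_tail q1 n.
set A := rnorm (_ *: _); set B := rnorm (Q (T x)); set C := rnorm (Q (T _)).
set D := rnorm (T (Q x)); set F := rnorm (Q (tail_shift _ _ _)) => hB hQ hx.
have hA : A <= n.+1%:R^-1 * rnorm x.
  rewrite /A rnormZ_real ?invr_ge0// ler_wpM2l ?invr_ge0//.
  rewrite (le_trans (ler_coord_mask _ _ _))// (le_trans (ler_bop _ T1))//.
  exact: ler_coord_mask.
have hD : D <= rnorm (Q x) by exact: ler_bop.
have hC : C <= D by exact: ler_coord_mask.
have hF : F <= rnorm (Q x).
  by rewrite /F tail_tail_shift -tail_shift_tail ler_coord_mask.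
move: (le_trans hA hx) hB (le_trans hC (le_trans hD hQ)) (le_trans hD hQ).
move: (le_trans hF hQ).
clearbody A B C D F => {hA hD hC hF hx hQ}.
by lra.
Qed.

Lemma approximant_adjoint_cvg T (phi : dual X) : 1 < q -> opnorm T <= 1 ->
  adjoint (approximant T n) phi @[n --> \oo] --> adjoint T phi.
Proof.
move=> lt1q T1; apply/cvg_rnormP => e e0; have e60 : 0 < e / 6 by rewrite divr_gt0.
have [N1 N1P] := exists_invn_mul_le (opnorm_ge0 phi) e60.
have [N2 N2P] := dual_tail_cvg0 phi lt1q e60.
have [N3 N3P] := dual_tail_cvg0 (adjoint T phi) lt1q e60.
exists (maxn N1 (maxn N2 N3)) => // n /=; rewrite !geq_max => /and3P[n1 n2 n3].
have {}N1P := N1P n n1; have {}N2P := N2P n n2; have {}N3P := N3P n n3.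
rewrite rnorm_bop (@le_lt_trans _ _ (5 * (e / 6)))//; last by lra.
apply: opnorm_le => [|x]; first by rewrite mulr_ge0// ltW.
have -> : (adjoint (approximant T n) phi - adjoint T phi) x =
    phi (approximant T n x - T x) by rewrite linearB.
rewrite approximant_sub !linearD !linearN linearZ (le_trans (ler_rnorm5 _ _ _ _ _))//.
set Q := proj_tail q1 n.
have phiQ y : rnorm y <= rnorm x -> rnorm (phi (Q y)) <= e / 6 * rnorm x.
  move=> yx; rewrite (le_trans (le_opnorm (bop_comp phi Q) y))//.
  by rewrite ler_pM ?opnorm_ge0 ?rnorm_ge0.
have Tx y : rnorm y <= rnorm x -> rnorm (T y) <= rnorm x.
  by move=> yx; rewrite (le_trans (ler_bop _ T1)).
have Mx p s y : rnorm y <= rnorm x -> rnorm (coord_mask q1 p s y) <= rnorm x.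
  by move=> yx; rewrite (le_trans (ler_coord_mask _ _ _)).
have -> : 5 * (e / 6) * rnorm x = e / 6 * rnorm x + e / 6 * rnorm x +
  e / 6 * rnorm x + e / 6 * rnorm x + e / 6 * rnorm x by ring.
rewrite !lerD//.
- rewrite /= rnormZ_real ?invr_ge0//.
  apply: (@le_trans _ _ (n.+1%:R^-1 * opnorm phi * rnorm x)).
    rewrite -mulrA ler_wpM2l ?invr_ge0// (le_trans (le_opnorm _ _))//.
    by rewrite ler_wpM2l ?opnorm_ge0//; exact/Mx/Tx/Mx.
  by rewrite ler_wpM2r ?rnorm_ge0.
- exact/phiQ/Tx.
- exact/phiQ/Tx/Mx.
- rewrite (le_trans (le_opnorm (bop_comp (adjoint T phi) Q) x))//.
  by rewrite ler_wpM2r ?rnorm_ge0.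
- exact/phiQ/Mx.
Qed.

End approximant_convergence.

(** * Genericity *)

Section genericity.

(** The intersection of the [U i] is a Gdelta, and it is dense because every
    point of [A] is a limit of points of [A] that belong to all the [U i]. *)
Lemma typical_of_open_approx (Y : topologicalType) (I : countType)
    (A P : set Y) (U : I -> set Y) :
  (forall i, open (U i)) ->
  (forall T, A T -> (forall i, U i T) -> P T) ->
  (forall T, A T -> exists S : nat -> Y,
    (forall n, A (S n) /\ forall i, U i (S n)) /\ S @ \oo --> T) ->
  typical A P.
Proof.
move=> oU UP AS.
pose F n : set (set_type A) :=
  if unpickle n is Some i then set_val @^-1` (U i) else setT.
exists (\bigcap_n F n); split.
- exists F => // n; rewrite /F; case: unpickle => [i|]; last exact: openT.
  by exists (U i).
- move=> O [T OT] oO.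
  have [S [SU ST]] := AS (set_val T) (set_valP T).
  pose S' n : set_type A := SigSub (mem_set (SU n).1).
  have S'T : S' @ \oo --> (T : initial_topology (@set_val Y A)).
    by apply/initial_cvgP; exact: ST.
  have [N _ /(_ N (leqnn N)) ON] : \forall n \near \oo, O (S' n).
    by apply: S'T; exact: open_nbhs_nbhs.
  exists (S' N); split=> // n _; rewrite /F; case: unpickle => // i.
  exact: (SU N).2.
- move=> T FT; apply: UP => [|i]; first exact: set_valP.
  by have := FT (pickle i) Logic.I; rewrite /F pickleK.
Qed.

Context {R : realType} (q : R) (q1 : 1 <= q).
Let X := lq q1.
Local Notation b j := (@basis_vector R q q1 j%N).

(** The map [ev] forgets the topology, so that the same argument applies to
    every topology that makes evaluations continuous. *)
Section evaluation_continuous.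
Context (Y : topologicalType) (ev : Y -> bop X X)
  (ev_continuous : forall x, continuous (fun S => ev S x)).

Lemma agrees_near (T : Y) n d a c : agrees (ev T) n d a c ->
  \forall S \near T, agrees (ev S) n d a c.
Proof.
elim: n => [|n IH] Tn; first by apply: nearW => S i.
have d0 : 0 < d - rnorm (ev T (a n) - c n) by rewrite subr_gt0 Tn.
have /cvg_rnormP/(_ _ d0) Sn := @ev_continuous (a n) T.
have {}IH := IH (fun i ni => Tn i (leqW ni)).
apply: filterS2 IH Sn => S IH Sn i; rewrite ltnS leq_eqVlt.
case/predU1P=> [->|]; last exact: IH.
rewrite (le_lt_trans (ler_rnorm_distD (ev T (a n)) _ _))// -ltrBrDr.
exact: Sn.
Qed.

Lemma open_shift_like k d : open (ev @^-1` (shift_like k d : set (bop X X))).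
Proof.
rewrite openE => T [N TN]; rewrite /interior.
by apply: filterS (agrees_near TN) => S SN; exists N.
Qed.

Lemma open_vanishing_orbit (x : X) e : open (ev @^-1` vanishing_orbit x e).
Proof.
rewrite openE => T [n [d [y [y0 nd Ty]]]]; rewrite /interior.
by apply: filterS (agrees_near Ty) => S Sy; exists n, d, y.
Qed.

Theorem typical_positive_contractions :
  (forall T, positive_contractions q1 (ev T) -> exists S : nat -> Y,
    (forall n, ev (S n) = approximant (ev T) n) /\ S @ \oo --> T) ->
  typical (ev @^-1` positive_contractions q1) (ev @^-1` typical_properties q1).
Proof.
move=> approx.
pose U (jk : nat * nat) : set Y := ev @^-1` (shift_like jk.2 jk.2.+1%:R^-1 `&`
  vanishing_orbit (b jk.1) jk.2.+1%:R^-1).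
apply: (@typical_of_open_approx _ _ _ _ U) => [jk|T [_ T1] TU|T [posT T1]].
- rewrite /U preimage_setI.
  by apply: openI; [exact: open_shift_like|exact: open_vanishing_orbit].
- apply: shift_like_typical_properties => // [k|j k]; first exact: (TU (0%N, k)).1.
  exact: (TU (j, k)).2.
have [S [SE ST]] := approx T (conj posT T1); exists S; split=> // n; split.
  rewrite /= SE; split; first exact: approximant_positive.
  exact: approximant_contraction.
move=> jk; rewrite /U /= SE; split.
  by apply: approximant_shift_like; rewrite invr_gt0.
by apply: approximant_vanishing_orbit; rewrite ?invr_gt0.
Qed.

End evaluation_continuous.

End genericity.

Theorem proposition3p1 (R : realType) (q : R) (q1 : 1 <= q) :
  typical (positive_contractions q1 : set (SOT (lq q1) (lq q1)))
          (typical_properties q1) /\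
  (1 < q ->
   typical (positive_contractions q1 : set (SOTstar (lq q1) (lq q1)))
           (typical_properties q1)).
Proof.
split=> [|lt1q].
  apply: (@typical_positive_contractions R q q1 (SOT (lq q1) (lq q1)) id).
    move=> x T; have /SOT_cvgP := @cvg_id _ (nbhs (T : SOT (lq q1) (lq q1))).
    exact.
  move=> T [_ T1]; exists (approximant T); split=> //.
  by apply/SOT_cvgP => x; exact: approximant_cvg.
apply: (@typical_positive_contractions R q q1 (SOTstar (lq q1) (lq q1)) id).
  move=> x T; have /SOTstar_cvgP[+ _] := @cvg_id _ (nbhs (T : SOTstar (lq q1) (lq q1))).
  exact.
move=> T [_ T1]; exists (approximant T); split=> //.
apply/SOTstar_cvgP; split=> [x|phi]; first exact: approximant_cvg.
exact: approximant_adjoint_cvg.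
Qed.
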